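(* Let $K$ be a field of characteristic $0$, let $A,A'$ be commutative unital $K$-algebras, let $C$ be a cocommutative $K$-coalgebra and let $\Phi:C\to\mathrm{Hom}_K(A,A')$ be a measuring of algebras. For each $x\in C$ the following diagrams commute: $$\begin{array}{ccc}\Omega_A^\bullet&\xrightarrow{\varepsilon_\bullet}&HH_\bullet(A)\\ {\scriptstyle\Omega^\bullet_\Phi(x)}\downarrow&&\downarrow{\scriptstyle HH_\bullet^\Phi(x)}\\ \Omega_{A'}^\bullet&\xrightarrow{\varepsilon_\bullet}&HH_\bullet(A')\end{array}\qquad\qquad\begin{array}{ccc}HH_\bullet(A)&\xrightarrow{\pi_\bullet}&\Omega_A^\bullet\\ {\scriptstyle HH_\bullet^\Phi(x)}\downarrow&&\downarrow{\scriptstyle\Omega^\bullet_\Phi(x)}\\ HH_\bullet(A')&\xrightarrow{\pi_\bullet}&\Omega_{A'}^\bullet\end{array}$$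
   Context: Write $\Delta_C(x)=x_{(1)}\otimes x_{(2)}$ (Sweedler, sums suppressed; likewise iterated). A measuring $\Phi:C\to\mathrm{Hom}_K(A,A')$ is a $K$-linear map with $\Phi(x)(ab)=\Phi(x_{(1)})(a)\Phi(x_{(2)})(b)$ and $\Phi(x)(1_A)=\epsilon_C(x)1_{A'}$; write $x(a)=\Phi(x)(a)$. $HH_\bullet(A)$ is the homology of the Hochschild complex $C_n(A)=A^{\otimes n+1}$, and $HH^\Phi_\bullet(x)$ is induced by $(a_0,\dots,a_n)\mapsto(x_{(1)}(a_0),\dots,x_{(n+1)}(a_n))$. $\Omega^0_A=A$, $\Omega_A^1$ is the module of Kähler differentials of $A$ over $K$, and $\Omega^p_A=\wedge^p_A\Omega^1_A$. $\Omega^p_\Phi(x):\Omega^p_A\to\Omega^p_{A'}$ is the (well-defined) map $a_0da_1\cdots da_p\mapsto x_{(1)}(a_0)d(x_{(2)}(a_1))\cdots d(x_{(p+1)}(a_p))$. The maps $\varepsilon_p:\Omega^p_A\to HH_p(A)$ and $\pi_p:HH_p(A)\to\Omega_A^p$ are induced by $$\varepsilon_p(a_0da_1\cdots da_p)=\sum_{\sigma\in S_p}\mathrm{sgn}(\sigma)(a_0,a_{\sigma^{-1}(1)},\dots,a_{\sigma^{-1}(p)}),\qquad\pi_p(a_0\otimes a_1\otimes\cdots\otimes a_p)=a_0da_1\cdots da_p .$$ *)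

(* Defs.v *)
From HB Require Import structures.
From mathcomp Require Import freeg.
From mathcomp Require Import all_boot fingroup perm all_algebra.
From mathcomp Require Import boolp.

Set Implicit Arguments.
Unset Strict Implicit.
Unset Printing Implicit Defensive.

Import GRing.Theory.

Local Open Scope ring_scope.
Local Open Scope quotient_scope.

(* "The linear map induced by g i |-> h i". It is applied below only to families
   g that generate V, so that there is at most one linear map sending every g i
   to h i. If that prescription is not well defined, the value is the zero map. *)
Definition induced (R : pzRingType) (V W : lmodType R) (I : Type)
    (g : I -> V) (h : I -> W) : {linear V -> W} :=
  match pselect (exists f : {linear V -> W}, forall i, f (g i) = h i) with
  | left e => projT1 (cid e)
  | right _ => \0
  end.

Lemma inducedE (R : pzRingType) (V W : lmodType R) (I : Type)
    (g : I -> V) (h : I -> W) :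
  (exists f : {linear V -> W}, forall i, f (g i) = h i) ->
  forall i, induced g h (g i) = h i.
Proof. by rewrite /induced; case: pselect => // e _; case: cid. Qed.

Section Quotient.
Variables (R : pzRingType) (V : lmodType R) (S : V -> Prop).

Inductive span : V -> Prop :=
| span_gen v : S v -> span v
| span0 : span 0
| spanD u v : span u -> span v -> span (u + v)
| spanZ k v : span v -> span (k *: v).

Definition span_pred : {pred V} := fun v => `[< span v >].

Fact span_submod : submod_closed span_pred.
Proof.
split; first exact/asboolP/span0.
move=> k u v /asboolP su /asboolP sv; apply/asboolP.
by apply: spanD => //; apply: spanZ.
Qed.

HB.instance Definition _ := GRing.isSubmodClosed.Build R V span_pred
  (GRing.submod_closed_semi span_submod).

(* V modulo the submodule generated by S. *)
Definition quotmod := Quotient.quot span_pred.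

HB.instance Definition _ := GRing.Zmodule.on quotmod.

Definition quotmod_pi (v : V) : quotmod := \pi_quotmod v.

Lemma quotmod_piP u v : quotmod_pi u = quotmod_pi v <-> span (u - v).
Proof.
split=> [/eqP|s]; first by rewrite eqmodE => /asboolP.
by apply/eqP; rewrite eqmodE; apply/asboolP.
Qed.

Definition quotmod_scale (k : R) (q : quotmod) : quotmod :=
  quotmod_pi (k *: generic_quotient.repr q).

Lemma quotmod_reprK q : quotmod_pi (generic_quotient.repr q) = q.
Proof. exact: reprK. Qed.

Lemma quotmod_piD : {morph quotmod_pi : u v / u + v}.
Proof. by move=> u v; rewrite /quotmod_pi !piE. Qed.

Lemma quotmod_piZ k v : quotmod_pi (k *: v) = quotmod_scale k (quotmod_pi v).
Proof.
apply/quotmod_piP; rewrite -scalerBr; apply: spanZ; apply/quotmod_piP.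
by rewrite quotmod_reprK.
Qed.

Fact quotmod_scaleA a b v :
  quotmod_scale a (quotmod_scale b v) = quotmod_scale (a * b) v.
Proof. by rewrite -(quotmod_reprK v) -!quotmod_piZ scalerA. Qed.

Fact quotmod_scale1 : left_id 1 quotmod_scale.
Proof. by move=> v; rewrite -(quotmod_reprK v) -!quotmod_piZ scale1r. Qed.

Fact quotmod_scaleDr : right_distributive quotmod_scale +%R.
Proof.
move=> a u v; rewrite -(quotmod_reprK u) -(quotmod_reprK v).
by rewrite -quotmod_piD -!quotmod_piZ -quotmod_piD scalerDr.
Qed.

Fact quotmod_scaleDl v : {morph quotmod_scale^~ v : a b / a + b}.
Proof.
by move=> a b; rewrite -(quotmod_reprK v) -!quotmod_piZ -quotmod_piD scalerDl.
Qed.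

HB.instance Definition _ := GRing.Zmodule_isLmodule.Build R quotmod
  quotmod_scaleA quotmod_scale1 quotmod_scaleDr quotmod_scaleDl.

Fact quotmod_pi_linear : linear quotmod_pi.
Proof. by move=> k u v; rewrite quotmod_piD quotmod_piZ. Qed.

HB.instance Definition _ :=
  GRing.isLinear.Build R V quotmod _ quotmod_pi quotmod_pi_linear.

Lemma quotmod_lift (W : lmodType R) (f : {linear V -> W}) :
  (forall v, S v -> f v = 0) ->
  exists g : {linear quotmod -> W}, forall v, g (quotmod_pi v) = f v.
Proof.
move=> fS; pose g (q : quotmod) := f (generic_quotient.repr q).
have f_span v : span v -> f v = 0.
  elim=> {v} [v /fS //||u v _ fu _ fv|k v _ fv]; first exact: linear0.
    by rewrite linearD fu fv addr0.
  by rewrite linearZ /= fv scaler0.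
have gE v : g (quotmod_pi v) = f v.
  apply/eqP; rewrite -subr_eq0 -linearB; apply/eqP/f_span.
  by apply/quotmod_piP; rewrite quotmod_reprK.
have g_lin : linear g.
  move=> k u v; rewrite -(quotmod_reprK u) -(quotmod_reprK v).
  by rewrite -linearP !gE linearP.
pose gL := GRing.isLinear.Build R quotmod W _ g g_lin.
by pose gl : {linear quotmod -> W} := HB.pack g gL; exists gl.
Qed.

End Quotient.

Section Kernel.
Variables (R : pzRingType) (V W : lmodType R) (f : {linear V -> W}).

Definition ker_pred : {pred V} := fun v => f v == 0.

Fact ker_submod : submod_closed ker_pred.
Proof.
split; first by rewrite unfold_in linear0.
move=> k u v /eqP fu /eqP fv.
by rewrite unfold_in linearP fu fv scaler0 addr0.
Qed.

HB.instance Definition _ := GRing.isSubmodClosed.Build R V ker_pred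
  (GRing.submod_closed_semi ker_submod).

Record kermod := Kermod { kermod_val :> V; _ : kermod_val \in ker_pred }.

HB.instance Definition _ := [isSub for kermod_val].
HB.instance Definition _ := [Choice of kermod by <:].
HB.instance Definition _ := [SubChoice_isSubLmodule of kermod by <:].

End Kernel.

Section FreeModule.
Variables (R : comNzRingType) (X : choiceType) (W : lmodType R) (h : X -> W).

Lemma fglift_linear : linear (fglift h).
Proof.
have hB := lift_is_additive h.
have h0 : fglift h 0 = 0 by have := hB 0 0; rewrite !subrr.
have hN w : fglift h (- w) = - fglift h w by rewrite -sub0r hB h0 sub0r.
have hD w w' : fglift h (w + w') = fglift h w + fglift h w'.
  by rewrite -{1}(opprK w') hB hN opprK.
move=> k u v; rewrite hD; congr (_ + _).
have hS s (F : X -> {freeg X / R}) :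
    fglift h (\sum_(x <- s) F x) = \sum_(x <- s) fglift h (F x).
  by elim: s => [|x s IHs]; rewrite ?big_nil ?big_cons ?h0 // hD IHs.
rewrite -[in RHS](freeg_sumE u) {1}/GRing.scale /= /fgscale !hS scaler_sumr.
by apply: eq_bigr => x _; rewrite !liftU scalerA.
Qed.

Lemma freeg_lift :
  exists g : {linear {freeg X / R} -> W}, forall x, g << x >> = h x.
Proof.
pose gL := GRing.isLinear.Build R _ W _ _ fglift_linear.
pose gl : {linear {freeg X / R} -> W} := HB.pack (fglift h) gL.
by exists gl => x /=; rewrite liftU scale1r.
Qed.

End FreeModule.

Section TensorPower.
Variables (R : comNzRingType) (n : nat) (V : lmodType R).

Definition free_tens (v : 'I_n -> V) : {freeg {ffun 'I_n -> V} / R} :=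
  << [ffun i => v i] >>.

Inductive multilinear_rel : {freeg {ffun 'I_n -> V} / R} -> Prop :=
| MultilinearRel v i k x y : multilinear_rel
    (free_tens [eta v with i |-> k *: x + y]
     - (k *: free_tens [eta v with i |-> x] + free_tens [eta v with i |-> y])).

Definition tpow := quotmod multilinear_rel.
HB.instance Definition _ := GRing.Lmodule.on tpow.

Definition tens (v : 'I_n -> V) : tpow := quotmod_pi _ (free_tens v).

Definition tlift (W : lmodType R) (h : ('I_n -> V) -> W) : {linear tpow -> W} :=
  induced tens h.

Definition multilinear (W : lmodType R) (h : ('I_n -> V) -> W) :=
  forall v i k x y, h [eta v with i |-> k *: x + y] =
    k *: h [eta v with i |-> x] + h [eta v with i |-> y].

Lemma tlift_tens (W : lmodType R) (h : ('I_n -> V) -> W) :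
  multilinear h -> forall v, tlift h (tens v) = h v.
Proof.
move=> hM; apply: inducedE.
have [g gE] := freeg_lift (fun v : {ffun 'I_n -> V} => h v).
have gtE v : g (free_tens v) = h v.
  by rewrite gE; congr h; apply/funext => i; rewrite ffunE.
have [|f fE] := @quotmod_lift _ _ multilinear_rel W g.
  by move=> _ [v i k x y]; rewrite linearB linearP !gtE hM subrr.
by exists f => v; rewrite /tens fE gtE.
Qed.

Lemma tens_multilinear : multilinear tens.
Proof.
move=> v i k x y; rewrite /tens -linearP; apply/quotmod_piP.
exact/span_gen/MultilinearRel.
Qed.

End TensorPower.

Section TensorOps.
Variables (R : comNzRingType) (V : lmodType R).

(* t |-> c (x) t, and t |-> t (x) c. *)
Definition tcons n (c : V) : {linear tpow n V -> tpow n.+1 V} :=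
  tlift (fun v => tens (fun i => if unlift ord0 i is Some j then v j else c)).

Definition trcons n (c : V) : {linear tpow n V -> tpow n.+1 V} :=
  tlift (fun v => tens (fun i => if unlift ord_max i is Some j then v j else c)).

End TensorOps.

Arguments tcons {R V n} c.
Arguments trcons {R V n} c.

HB.mixin Record isCoalgebra (K : fieldType) C of GRing.Lmodule K C := {
  comul : {linear C -> tpow 2 C};
  counit : {linear C -> K^o};
  comulA : forall x : C,
    tlift (fun c => tcons (c ord0) (comul (c ord_max))) (comul x) =
    tlift (fun c => trcons (c ord_max) (comul (c ord0))) (comul x);
  counitl : forall x : C,
    tlift (fun c => counit (c ord0) *: c ord_max) (comul x) = x;
  counitr : forall x : C,
    tlift (fun c => counit (c ord_max) *: c ord0) (comul x) = x
}.

#[short(type="coalgType")]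
HB.structure Definition Coalgebra (K : fieldType) :=
  {C of isCoalgebra K C & GRing.Lmodule K C}.

HB.mixin Record Coalgebra_isCocommutative (K : fieldType) C
    of Coalgebra K C := {
  comulC : forall x : C,
    tlift (fun c => tens (fun i => c (rev_ord i))) (comul x) = comul x
}.

#[short(type="cocomCoalgType")]
HB.structure Definition CocomCoalgebra (K : fieldType) :=
  {C of Coalgebra_isCocommutative K C & Coalgebra K C}.

Section Sweedler.
Variables (K : fieldType) (C : coalgType K).

(* icomul n x is x_(1) (x) ... (x) x_(n+1). *)
Fixpoint icomul (n : nat) (x : C) : tpow n.+1 C :=
  if n is m.+1 then
    tlift (fun c => tcons (c ord0) (icomul m (c ord_max))) (comul x)
  else tens (fun=> x).

(* The Sweedler sum h (x_(1), ..., x_(n+1)), for a multilinear h. *)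
Definition sweedler (W : lmodType K) (n : nat) (h : ('I_n.+1 -> C) -> W)
    (x : C) : W :=
  tlift h (icomul n x).

End Sweedler.

Record measuring (K : fieldType) (C : coalgType K) (A A' : comAlgType K) :=
  Measuring {
    meas_fun :> C -> {linear A -> A'};
    meas_linear : forall a, linear (fun x => meas_fun x a);
    measM : forall x a b, meas_fun x (a * b) =
      tlift (fun c => meas_fun (c ord0) a * meas_fun (c ord_max) b) (comul x);
    meas1 : forall x, meas_fun x 1 = (counit x : K) *: 1
  }.

Section Hochschild.
Variables (K : fieldType) (A : comAlgType K).

Definition hoch (n : nat) := tpow n.+1 A.
HB.instance Definition _ n := GRing.Lmodule.on (hoch n).

(* (a_0, ..., a_i a_(i+1), ..., a_(n+1)) *)
Definition hface n (a : 'I_n.+2 -> A) (i j : 'I_n.+1) : A :=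
  if (j < i)%N then a (widen_ord (leqnSn _) j)
  else if j == i then a (widen_ord (leqnSn _) j) * a (lift ord0 j)
  else a (lift ord0 j).

(* (a_(n+1) a_0, a_1, ..., a_n) *)
Definition hface_last n (a : 'I_n.+2 -> A) (j : 'I_n.+1) : A :=
  if j == ord0 then a ord_max * a ord0 else a (widen_ord (leqnSn _) j).

Definition hoch_b n : {linear hoch n.+1 -> hoch n} :=
  tlift (fun a => \sum_(i < n.+1) (-1) ^+ i *: tens (hface a i)
                  + (-1) ^+ n.+1 *: tens (hface_last a)).

(* The differential out of degree n; it vanishes on degree 0. *)
Definition hoch_d n : {linear hoch n -> hoch n.-1} :=
  match n with 0 => \0 | m.+1 => hoch_b m end.

Definition hoch_cycle n := kermod (hoch_d n).
HB.instance Definition _ n := GRing.Lmodule.on (hoch_cycle n).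

Definition HH n :=
  quotmod (fun z : hoch_cycle n => exists c, hoch_b n c = kermod_val z).
HB.instance Definition _ n := GRing.Lmodule.on (HH n).

Definition HH_class n (z : hoch_cycle n) : HH n := quotmod_pi _ z.

(* The homology class of a chain c which is a cycle (the zero class when c is
   not a cycle). *)
Definition HH_of n (c : hoch n) : HH n := HH_class (insubd 0 c).

End Hochschild.

Section Forms.
Variables (K : fieldType) (A : comAlgType K).

Inductive kaehler_rel : {freeg A / A} -> Prop :=
| KaehlerLinear (k : K) a b :
    kaehler_rel (<< k *: a + b >> - (k%:A *: << a >> + << b >>))
| KaehlerLeibniz a b :
    kaehler_rel (<< a * b >> - (a *: << b >> + b *: << a >>)).

Definition Omega1 := quotmod kaehler_rel.
HB.instance Definition _ := GRing.Lmodule.on Omega1.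

Definition kaehler_d (a : A) : Omega1 := quotmod_pi _ << a >>.

End Forms.

Section Exterior.
Variables (R : comNzRingType) (p : nat) (M : lmodType R).

Inductive alternating_rel : tpow p M -> Prop :=
| AlternatingRel v i j : i != j -> v i = v j -> alternating_rel (tens v).

(* For p = 0 the module is free of rank one on the empty wedge: there is no
   relation, and the 0-th tensor power is free on the unique map from 'I_0. *)
Definition extpow := quotmod alternating_rel.
HB.instance Definition _ := GRing.Lmodule.on extpow.

Definition wedge (v : 'I_p -> M) : extpow := quotmod_pi _ (tens v).

End Exterior.

Section RestrictScalars.
Variables (K : fieldType) (A : comAlgType K) (M : lmodType A).

Definition restr : Type := M.
HB.instance Definition _ := GRing.Zmodule.on restr.
Definition restr_scale (k : K) (m : restr) : restr := (k%:A : A) *: (m : M).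

Fact restr_scaleA a b v :
  restr_scale a (restr_scale b v) = restr_scale (a * b) v.
Proof. by rewrite /restr_scale scalerA -scalerAl mul1r scalerA. Qed.

Fact restr_scale1 : left_id 1 restr_scale.
Proof. by move=> v; rewrite /restr_scale scale1r; exact: (@scale1r _ M). Qed.

Fact restr_scaleDr : right_distributive restr_scale +%R.
Proof. by move=> a u v; exact: (@scalerDr _ M). Qed.

Fact restr_scaleDl v : {morph restr_scale^~ v : a b / a + b}.
Proof.
by move=> a b; rewrite /restr_scale scalerDl; exact: (@scalerDl _ M).
Qed.

HB.instance Definition _ := GRing.Zmodule_isLmodule.Build K restr
  restr_scaleA restr_scale1 restr_scaleDr restr_scaleDl.

Definition to_restr (m : M) : restr := m.

Lemma to_restrD (m n : M) : to_restr (m + n) = to_restr m + to_restr n.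
Proof. by []. Qed.

Lemma to_restrZ (k : K) (m : M) :
  to_restr ((k%:A : A) *: m) = k *: to_restr m.
Proof. by []. Qed.

End RestrictScalars.

Section DifferentialForms.
Variables (K : fieldType) (A : comAlgType K).

Definition Omega p := restr (extpow p (Omega1 A)).
HB.instance Definition _ p := GRing.Lmodule.on (Omega p).

(* a_0 da_1 ... da_p; for p = 0 this identifies A with Omega 0. *)
Definition dform p (a : 'I_p.+1 -> A) : Omega p :=
  to_restr (a ord0 *: wedge (fun i => kaehler_d (a (lift ord0 i)))).

(* (a_0, a_(s^-1 1), ..., a_(s^-1 p)) *)
Definition act_args p (s : 'S_p) (a : 'I_p.+1 -> A) (i : 'I_p.+1) : A :=
  if unlift ord0 i is Some j then a (lift ord0 (s^-1%g j)) else a ord0.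

Definition antisym p (a : 'I_p.+1 -> A) : hoch A p :=
  \sum_(s : 'S_p) (-1) ^+ s *: tens (act_args s a).

Definition eps p : {linear Omega p -> HH A p} :=
  induced (@dform p) (fun a => HH_of (antisym a)).

Definition pi_chain p : {linear hoch A p -> Omega p} := tlift (@dform p).

Definition hpi p : {linear HH A p -> Omega p} :=
  induced (@HH_class K A p) (fun z => pi_chain p (kermod_val z)).

End DifferentialForms.

Section InducedByMeasuring.
Variables (K : fieldType) (C : coalgType K) (A A' : comAlgType K).
Variables (Phi : measuring C A A') (x : C) (p : nat).

Definition hoch_meas : {linear hoch A p -> hoch A' p} :=
  tlift (fun a =>
    sweedler (fun c : 'I_p.+1 -> C => tens (fun i => Phi (c i) (a i))) x).

Definition HH_meas : {linear HH A p -> HH A' p} :=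
  induced (@HH_class K A p) (fun z => HH_of (hoch_meas (kermod_val z))).

Definition Omega_meas : {linear Omega A p -> Omega A' p} :=
  induced (@dform K A p) (fun a =>
    sweedler (fun c : 'I_p.+1 -> C => dform (fun i => Phi (c i) (a i))) x).

End InducedByMeasuring.

(* Main.v *)
Require Import Defs.
From HB Require Import structures.
From mathcomp Require Import zify freeg.
From mathcomp Require Import all_boot fingroup perm all_algebra.
From mathcomp Require Import boolp.

(** The four maps are prescribed by formulas on generators, and on generators
   the two squares are short computations. The content is that the formulas
   define linear maps.

   Action on Hochschild homology. Every face multiplies two entries of a chain.
   By the measuring rule, acting on a product splits one component of the
   iterated coproduct of [x] in two. Coassociativity performs this splitting for
   the first component, and cocommutativity makes Sweedler sums symmetric
   ([sweedler_perm]), so that any component can be split and its halves placed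
   anywhere ([sweedler_double]). Hence all faces, the cyclic one included,
   commute with the action ([hoch_meas_b]).

   Projection to forms. On a boundary the Leibniz rule writes each face as two
   forms, and the alternating sum telescopes ([pi_chain_b]).

   Antisymmetrization. As [A] is commutative, antisymmetrized chains are cycles
   ([alt_cycle]). In each differential the Leibniz rule holds up to an explicit
   boundary, that of the antisymmetrization restricted to the arrangements in
   which one factor precedes the other ([alt_leibniz]). The universal property
   of forms ([Omega_lift]) then yields a [K]-linear map; since forms are built
   over [A], it is obtained through the coinduced module of linear maps out of
   [A].

   Action on forms. Antisymmetrizing and projecting back multiplies by the
   factorial of [p] ([pi_chain_antisym]). In characteristic [0] the action on
   forms can therefore be obtained from the one on homology ([Omega_measE]).

   The first square now follows from the symmetry of Sweedler sums, which lets
   the action commute with antisymmetrization ([hoch_meas_antisym]); the second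
   already commutes on chains ([Omega_meas_pi_chain]). *)

Set Implicit Arguments.
Unset Strict Implicit.
Unset Printing Implicit Defensive.

Import GRing.Theory.
Local Open Scope ring_scope.

(* Not the span of a sequence of vectors. *)
Local Notation span := Defs.span.

(** * Updating and extending families *)

(** Convertible to the update notation in [multilinear]; a named function can
   be rewritten with. *)
Definition upd (I : eqType) (T : Type) (v : I -> T) (i : I) (x : T) : I -> T :=
  fun j => if j == i then x else v j.

Section Update.
Variables (I : eqType) (T : Type).
Implicit Types (v : I -> T) (i j : I) (x y : T).

Lemma upd_eq v i x : upd v i x i = x.
Proof. by rewrite /upd eqxx. Qed.

Lemma upd_neq v i j x : j != i -> upd v i x j = v j.
Proof. by rewrite /upd => /negPf->. Qed.

Lemma upd_id v i : upd v i (v i) = v.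
Proof. by apply/funext => j; rewrite /upd; case: eqP => [->|]. Qed.

Lemma upd_upd v i x y : upd (upd v i x) i y = upd v i y.
Proof. by apply/funext => j; rewrite /upd; case: eqP. Qed.

Lemma updC v i j x y : i != j -> upd (upd v i x) j y = upd (upd v j y) i x.
Proof.
move=> nij; apply/funext => k; rewrite /upd; case: (k =P j) => // ->.
by rewrite eq_sym (negPf nij).
Qed.

Lemma upd_comp (T' : Type) (f : I -> T -> T') v i x :
  (fun j => f j (upd v i x j)) = upd (fun j => f j (v j)) i (f i x).
Proof. by apply/funext => j; rewrite /upd; case: eqP => // ->. Qed.

End Update.

Lemma upd_perm (I : finType) (T : Type) (v : I -> T) (s : {perm I}) i x :
  (fun j => upd v i x (s j)) = upd (fun j => v (s j)) (s^-1%g i) x.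
Proof.
apply/funext => j; rewrite /upd; congr (if _ then _ else _).
by apply/eqP/eqP => [<-|->]; rewrite ?permK ?permKV.
Qed.

(** The families in [tcons] and [trcons] are of this shape, for the first and
   for the last place. *)
Definition ins (n : nat) (T : Type) (p : 'I_n.+1) (c : T) (v : 'I_n -> T) :
    'I_n.+1 -> T :=
  fun j => if unlift p j is Some j' then v j' else c.

Section Insert.
Variables (n : nat) (T : Type).
Implicit Types (p : 'I_n.+1) (v : 'I_n -> T) (w : 'I_n.+1 -> T).

Lemma ins_id p c v : ins p c v p = c.
Proof. by rewrite /ins unlift_none. Qed.

Lemma ins_lift p c v j : ins p c v (lift p j) = v j.
Proof. by rewrite /ins liftK. Qed.

Lemma insK p w : ins p (w p) (w \o lift p) = w.
Proof. by apply/funext => j; rewrite /ins; case: unliftP => [k|] ->. Qed.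

Lemma upd_ins p c d v : upd (ins p c v) p d = ins p d v.
Proof.
apply/funext => j; rewrite /upd /ins; case: unliftP => [k|] -> /=.
  by rewrite eq_sym (negPf (neq_lift _ _)).
by rewrite eqxx.
Qed.

Lemma ins_upd p c v i x : ins p c (upd v i x) = upd (ins p c v) (lift p i) x.
Proof.
apply/funext => j; rewrite /upd /ins; case: unliftP => [k|] -> /=.
  by rewrite (inj_eq lift_inj).
by rewrite (negPf (neq_lift _ _)).
Qed.

End Insert.

(** * Multilinear maps and generating families *)

Section Multilinear.
Variables (R : comNzRingType) (n : nat).
Implicit Types (V W : lmodType R).

Lemma multilinearP V W (h : ('I_n -> V) -> W) :
  multilinear h <-> forall v i, linear (fun x => h (upd v i x)).
Proof. by split=> H v i k x y; apply: (H v i k x y). Qed.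

Lemma multilinear_lin V W (h : ('I_n -> V) -> W) v i :
  multilinear h -> linear (fun x => h (upd v i x)).
Proof. by move/multilinearP. Qed.

Lemma multilinear_comp V W W' (f : W -> W') (h : ('I_n -> V) -> W) :
  linear f -> multilinear h -> multilinear (fun v => f (h v)).
Proof. by move=> fL hM v i k x y; rewrite hM fL. Qed.

Lemma multilinear_arg V V' W (f : 'I_n -> V -> V') (h : ('I_n -> V') -> W) :
  (forall i, linear (f i)) -> multilinear h ->
  multilinear (fun v => h (fun i => f i (v i))).
Proof.
move=> fL hM v i k x y;
  have := multilinear_lin (fun i => f i (v i)) i hM k (f i x) (f i y).
by rewrite -fL -!upd_comp.
Qed.

Lemma multilinear_perm V W (s : 'S_n) (h : ('I_n -> V) -> W) :
  multilinear h -> multilinear (fun v => h (fun i => v (s i))).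
Proof.
move=> hM v i k x y; have := multilinear_lin (fun i => v (s i)) (s^-1%g i) hM k x y.
by rewrite -!upd_perm.
Qed.

Lemma multilinear_sum V W (I : Type) (r : seq I) (P : pred I)
    (h : I -> ('I_n -> V) -> W) :
  (forall i, multilinear (h i)) -> multilinear (fun v => \sum_(i <- r | P i) h i v).
Proof.
move=> hM v i k x y; rewrite scaler_sumr -big_split.
by apply: eq_bigr => j _; apply: hM.
Qed.

Lemma multilinear_add V W (h h' : ('I_n -> V) -> W) :
  multilinear h -> multilinear h' -> multilinear (fun v => h v + h' v).
Proof. by move=> hM hM' v i k x y; rewrite hM hM' scalerDr addrACA. Qed.

Lemma multilinear_scale V W a (h : ('I_n -> V) -> W) :
  multilinear h -> multilinear (fun v => a *: h v).
Proof. by move=> hM v i k x y; rewrite hM scalerDr !scalerA mulrC. Qed.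

End Multilinear.

Lemma multilinear_ins (R : comNzRingType) n (V W : lmodType R)
    (h : ('I_n.+1 -> V) -> W) p c :
  multilinear h -> multilinear (fun v => h (ins p c v)).
Proof.
move=> hM v i k x y; have := multilinear_lin (ins p c v) (lift p i) hM k x y.
by rewrite -!ins_upd.
Qed.

Lemma multilinear_ins_lin (R : comNzRingType) n (V W : lmodType R)
    (h : ('I_n.+1 -> V) -> W) p v :
  multilinear h -> linear (fun c => h (ins p c v)).
Proof.
by move=> hM k x y; have := multilinear_lin (ins p 0 v) p hM k x y;
  rewrite !upd_ins.
Qed.

Section Linear.
Variables (R : pzRingType) (V W W' : lmodType R).

Definition mklin (f : V -> W) (fL : linear f) : {linear V -> W} :=
  HB.pack f (GRing.isLinear.Build R V W _ f fL).

Lemma linear_of (f : {linear V -> W}) : linear f.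
Proof. exact: linearP. Qed.

Lemma lin0 (f : V -> W) : linear f -> f 0 = 0.
Proof. by move=> fL; apply: (linear0 (mklin fL)). Qed.

Lemma linZ (f : V -> W) k x : linear f -> f (k *: x) = k *: f x.
Proof. by move=> fL; have := fL k x 0; rewrite (lin0 fL) !addr0. Qed.

Lemma comp_lin (f : W -> W') (g : V -> W) :
  linear f -> linear g -> linear (fun x => f (g x)).
Proof. by move=> fL gL k x y; rewrite gL fL. Qed.

End Linear.

Section Spanning.
Variables (R : comNzRingType).

Lemma span_lin (V W : lmodType R) (S : V -> Prop) (f : V -> W) v :
  linear f -> span S v -> span (fun w => exists2 u, S u & w = f u) (f v).
Proof.
move=> fL; pose F := mklin fL; rewrite -[f]/(F : _ -> _).
elim=> {v} [v Sv||u v _ Hu _ Hv|k v _ Hv].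
- by apply: span_gen; exists v.
- by rewrite linear0; apply: span0.
- by rewrite linearD; apply: spanD.
- by rewrite linearZ; apply: spanZ.
Qed.

Lemma span_sub (V : lmodType R) (S S' : V -> Prop) v :
  (forall u, S u -> S' u) -> span S v -> span S' v.
Proof.
move=> SS'; elim=> {v} [v Sv||u v _ Hu _ Hv|k v _ Hv].
- exact/span_gen/SS'.
- exact: span0.
- exact: spanD.
- exact: spanZ.
Qed.

Lemma multilinearZ n (V W : lmodType R) (h : ('I_n -> V) -> W) v i k x :
  multilinear h -> h (upd v i (k *: x)) = k *: h (upd v i x).
Proof.
by move=> hM; apply: linZ (multilinear_lin v i hM).
Qed.

Lemma span_quot (V : lmodType R) (S T : V -> Prop) (q : quotmod T) :
  (forall v, span S v) ->
  span (fun q => exists2 u, S u & q = quotmod_pi T u) q.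
Proof.
by move=> HS; rewrite -(quotmod_reprK q); apply: span_lin;
  first exact: linear_of.
Qed.

Lemma span_freeg (X : choiceType) (u : {freeg X / R}) :
  span (fun w => exists x, w = << x >>) u.
Proof.
rewrite -(freeg_sumE u); elim/big_rec: _ => [|x w _ Hw]; first exact: span0.
apply: spanD => //.
have -> : << coeff x u *g x >> = coeff x u *: << x >> :> {freeg X / R}.
  by apply/eqP/freeg_eqP => y; rewrite coeffZ !coeffU mul1r.
by apply: spanZ; apply: span_gen; exists x.
Qed.

Lemma span_tpow n (V : lmodType R) (t : tpow n V) :
  span (fun t => exists v, t = tens v) t.
Proof.
apply: (span_sub _ (span_quot t (@span_freeg _))) => _ [_ [v ->] ->].
exists v; rewrite /tens /free_tens; congr (quotmod_pi _ << _ >>).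
by apply/ffunP => i; rewrite ffunE.
Qed.

Lemma span_extpow n (V : lmodType R) (t : extpow n V) :
  span (fun t => exists v, t = wedge v) t.
Proof.
apply: (span_sub _ (span_quot t (@span_tpow n V))) => _ [_ [v ->] ->].
by exists v.
Qed.

Lemma span_eq (V W : lmodType R) (S : V -> Prop) (f g : {linear V -> W}) v :
  span S v -> (forall u, S u -> f u = g u) -> f v = g v.
Proof.
move=> Hv Hfg; elim: Hv => {v} [v Sv||u v _ Hu _ Hv|k v _ Hv].
- exact: Hfg.
- by rewrite !linear0.
- by rewrite !linearD Hu Hv.
- by rewrite !linearZ Hv.
Qed.

Lemma tpow_ext n (V W : lmodType R) (f g : {linear tpow n V -> W}) :
  (forall v, f (tens v) = g (tens v)) -> f =1 g.
Proof. by move=> fg t; apply: (span_eq (span_tpow t)) => _ [v ->]. Qed.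

(** The arguments are expanded one after the other: after [k] rounds the first
   [k] arguments are arbitrary and only the others are taken in [G]. *)
Lemma multilinear_gen n (M N : lmodType R) (H : ('I_n -> M) -> N)
    (G : M -> Prop) (Q : N -> Prop) :
  multilinear H -> (forall m, span G m) ->
  Q 0 -> (forall x y, Q x -> Q y -> Q (x + y)) -> (forall k x, Q x -> Q (k *: x)) ->
  (forall v, (forall i, G (v i)) -> Q (H v)) -> forall v, Q (H v).
Proof.
move=> HM HG Q0 QD QZ HQ.
suff Hk k v : (forall i : 'I_n, (k <= i)%N -> G (v i)) -> Q (H v).
  by move=> v; apply: (Hk n) => i; rewrite leqNgt ltn_ord.
elim: k v => [|k IHk] v Gv; first by apply: HQ => i; apply: Gv.
case: (ltnP k n) => [lt_kn|le_nk]; last first.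
  by apply: IHk => i /(leq_trans le_nk); rewrite leqNgt ltn_ord.
pose i := Ordinal lt_kn; pose L := mklin (multilinear_lin v i HM).
have LE x : H (upd v i x) = L x by [].
suff Qi x : Q (H (upd v i x)) by rewrite -(upd_id v i).
rewrite LE; elim: (HG x) => {x} [x Gx||x y _ Hx _ Hy|a x _ Hx].
- rewrite -LE; apply: IHk => j; rewrite /upd leq_eqVlt.
  case: (j =P i) => // nij /orP[/eqP kj|]; last exact: Gv.
  by case: nij; apply: val_inj.
- by rewrite linear0.
- by rewrite linearD; apply: QD.
- by rewrite linearZ; apply: QZ.
Qed.

End Spanning.

Section TensorLift.
Variables (R : comNzRingType) (n : nat) (V W : lmodType R).

Lemma tlift_map (W' : lmodType R) (f : {linear W -> W'}) (h : ('I_n -> V) -> W) t :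
  multilinear h -> f (tlift h t) = tlift (fun v => f (h v)) t.
Proof.
move=> hM.
have Lfh : linear (fun t => f (tlift h t)).
  by apply: comp_lin; apply: linear_of.
rewrite -[LHS]/(mklin Lfh t); move: t; apply: tpow_ext => v /=.
by rewrite !tlift_tens //; apply: multilinear_comp => //; apply: linear_of.
Qed.

Lemma tlift_lin (k : R) (h h' : ('I_n -> V) -> W) t :
  multilinear h -> multilinear h' ->
  tlift (fun v => k *: h v + h' v) t = k *: tlift h t + tlift h' t.
Proof.
move=> hM hM'.
have L : linear (fun t => k *: tlift h t + tlift h' t).
  move=> a x y /=; rewrite (linearP (tlift h)) (linearP (tlift h')).
  by rewrite !scalerDr !scalerA (mulrC k) addrACA.
rewrite -[RHS]/(mklin L t); move: t; apply: tpow_ext => v /=.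
by rewrite !tlift_tens //; apply: multilinear_add => //;
  apply: multilinear_scale.
Qed.

End TensorLift.

(** * Sweedler sums *)

Definition bilin (R : comNzRingType) (U V W : lmodType R) (h : U -> V -> W) :=
  (forall u, linear (h u)) /\ (forall v, linear (h^~ v)).

Lemma bilin_multilinear (R : comNzRingType) (V W : lmodType R) (h : V -> V -> W) :
  bilin h -> multilinear (fun c : 'I_2 -> V => h (c ord0) (c ord_max)).
Proof.
move=> [hr hl] v i k x y /=; case: (i =P ord0) => [->|/eqP ni].
  by rewrite /= hl.
have -> : i = ord_max by case: i ni => -[|[|//]] ?; last by move=> *;
  apply: val_inj.
by rewrite /= hr.
Qed.

Lemma eq_tlift (R : comNzRingType) n (V W : lmodType R)
    (h h' : ('I_n -> V) -> W) t :
  h =1 h' -> tlift h t = tlift h' t.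
Proof. by move/funext->. Qed.

Lemma tcons_tens (R : comNzRingType) n (V : lmodType R) (c : V) (v : 'I_n -> V) :
  tcons c (tens v) = tens (ins ord0 c v).
Proof.
by rewrite tlift_tens //; apply: multilinear_ins; apply: tens_multilinear.
Qed.

Lemma trcons_tens (R : comNzRingType) n (V : lmodType R) (c : V) (v : 'I_n -> V) :
  trcons c (tens v) = tens (ins ord_max c v).
Proof.
by rewrite tlift_tens //; apply: multilinear_ins; apply: tens_multilinear.
Qed.

Lemma tcons_lin (R : comNzRingType) n (V : lmodType R) (t : tpow n V) :
  linear (fun c : V => tcons c t).
Proof.
move=> k x y.
have L : linear (fun t : tpow n V => k *: tcons x t + tcons y t).
  move=> a u v /=; rewrite (linearP (tcons x)) (linearP (tcons y)).
  by rewrite !scalerDr !scalerA (mulrC k) addrACA.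
rewrite -[RHS]/(mklin L t); move: t; apply: tpow_ext => v /=.
by rewrite !tcons_tens;
  apply: (multilinear_ins_lin ord0 v (@tens_multilinear R n.+1 V)).
Qed.

Lemma trcons_lin (R : comNzRingType) n (V : lmodType R) (t : tpow n V) :
  linear (fun c : V => trcons c t).
Proof.
move=> k x y.
have L : linear (fun t : tpow n V => k *: trcons x t + trcons y t).
  move=> a u v /=; rewrite (linearP (trcons x)) (linearP (trcons y)).
  by rewrite !scalerDr !scalerA (mulrC k) addrACA.
rewrite -[RHS]/(mklin L t); move: t; apply: tpow_ext => v /=.
by rewrite !trcons_tens;
  apply: (multilinear_ins_lin ord_max v (@tens_multilinear R n.+1 V)).
Qed.

Section Sweedler.
Variables (K : fieldType) (C : coalgType K).
Implicit Types (W : lmodType K).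

(** The Sweedler sum over two components, with a function of two arguments: the
   form in which coassociativity and cocommutativity get used. *)
Definition sweedler2 W (h : C -> C -> W) (x : C) : W :=
  tlift (fun c : 'I_2 -> C => h (c ord0) (c ord_max)) (comul x).

Lemma sweedler2_linear W (h : C -> C -> W) : linear (sweedler2 h).
Proof. by move=> k x y; rewrite /sweedler2 linearP linearP. Qed.

Lemma sweedler2_map W W' (f : W -> W') (h : C -> C -> W) x :
  linear f -> bilin h -> f (sweedler2 h x) = sweedler2 (fun u v => f (h u v)) x.
Proof.
by move=> fL hB; apply: (tlift_map (mklin fL)); apply: bilin_multilinear.
Qed.

Lemma eq_sweedler2 W (h h' : C -> C -> W) x :
  (forall u v, h u v = h' u v) -> sweedler2 h x = sweedler2 h' x.
Proof.
by move=> e; rewrite /sweedler2; congr (tlift _ _); apply/funext => c.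
Qed.

Lemma icomul_lin n : linear (@icomul K C n).
Proof.
elim: n => [|n IHn] k x y /=; last by rewrite linearP linearP.
have := multilinear_lin (fun=> 0) ord0 (@tens_multilinear K 1 C) k x y.
have E z : upd (fun=> 0) ord0 z = (fun _ : 'I_1 => z).
  by apply/funext => j; rewrite [j]ord1 upd_eq.
by rewrite !E.
Qed.

Lemma icomul_bilin n :
  bilin (fun u v : C => tcons u (@icomul K C n v)).
Proof.
split=> [u|v]; last exact: tcons_lin.
by apply: comp_lin; [apply: linear_of|apply: icomul_lin].
Qed.

Lemma sweedler_linear W n (h : ('I_n.+1 -> C) -> W) : linear (sweedler h).
Proof. by apply: comp_lin; [apply: linear_of|apply: icomul_lin]. Qed.

Lemma sweedler_map W W' (f : W -> W') n (h : ('I_n.+1 -> C) -> W) x :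
  linear f -> multilinear h -> f (sweedler h x) = sweedler (fun c => f (h c)) x.
Proof. by move=> fL hM; apply: (tlift_map (mklin fL)). Qed.

Lemma eq_sweedler W n (h h' : ('I_n.+1 -> C) -> W) x :
  h =1 h' -> sweedler h x = sweedler h' x.
Proof. by move/funext->. Qed.

Lemma sweedlerZ W n k (h : ('I_n.+1 -> C) -> W) x :
  multilinear h -> sweedler (fun c => k *: h c) x = k *: sweedler h x.
Proof.
by move=> hM; rewrite (sweedler_map (f := *:%R k)) //; apply: linear_of.
Qed.

Lemma sweedlerD W n (h h' : ('I_n.+1 -> C) -> W) x :
  multilinear h -> multilinear h' ->
  sweedler (fun c => h c + h' c) x = sweedler h x + sweedler h' x.
Proof.
move=> hM hM'; rewrite -[sweedler h x]scale1r /sweedler -tlift_lin //.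
by apply: eq_tlift => c; rewrite scale1r.
Qed.

Lemma sweedler_sum W n (I : Type) (r : seq I) (h : I -> ('I_n.+1 -> C) -> W) x :
  (forall i, multilinear (h i)) ->
  sweedler (fun c => \sum_(i <- r) h i c) x = \sum_(i <- r) sweedler (h i) x.
Proof.
move=> hM; elim: r => [|i r IHr].
  pose z (_ : 'I_n.+1 -> C) : W := 0;
    have ml0 : multilinear z by move=> v i k a b; rewrite /z scaler0 addr0.
  rewrite big_nil; transitivity (0 *: sweedler z x).
    by rewrite -sweedlerZ //; apply: eq_sweedler => c; rewrite big_nil scaler0.
  by rewrite scale0r.
rewrite big_cons -IHr -sweedlerD //; last exact: multilinear_sum.
by apply: eq_sweedler => c; rewrite big_cons.
Qed.

Lemma sweedler0 W (h : ('I_1 -> C) -> W) x :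
  multilinear h -> sweedler h x = h (fun=> x).
Proof. by move=> hM; rewrite /sweedler /= tlift_tens. Qed.

Lemma sweedlerS W n (h : ('I_n.+2 -> C) -> W) x : multilinear h ->
  sweedler h x = sweedler2 (fun u w => sweedler (fun c => h (ins ord0 u c)) w) x.
Proof.
move=> hM; rewrite {1}/sweedler /=.
rewrite (tlift_map (tlift h));
  last exact: (bilin_multilinear (@icomul_bilin n)).
apply: eq_tlift => c; rewrite /sweedler.
move: (icomul n _); have L : linear (fun t => tlift h (tcons (c ord0) t)).
  by apply: comp_lin; apply: linear_of.
apply: (tpow_ext (f := mklin L)) => v /=.
by rewrite tcons_tens !tlift_tens //; apply: multilinear_ins.
Qed.

Lemma sweedler_bilin W n (h : ('I_n.+2 -> C) -> W) : multilinear h ->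
  bilin (fun u w => sweedler (fun c => h (ins ord0 u c)) w).
Proof.
move=> hM; split=> [u|w]; first exact: sweedler_linear.
move=> k x y; rewrite /sweedler -tlift_lin; try exact: multilinear_ins.
by apply: eq_tlift => v; apply: (multilinear_ins_lin ord0 v hM).
Qed.

(** Both sides are linear in the tensor [comul y], so it is enough to compare
   them when [comul y] is replaced by a pure tensor. *)
Lemma sweedler_sweedler2 W n (g : ('I_n.+1 -> C) -> C -> C -> W) x y :
  (forall u v, multilinear (fun c => g c u v)) -> (forall c, bilin (g c)) ->
  sweedler (fun c => sweedler2 (g c) y) x
  = sweedler2 (fun u v => sweedler (fun c => g c u v) x) y.
Proof.
move=> gM gB; rewrite /sweedler2; move: (comul y) => t.
pose gt c := fun d : 'I_2 -> C => g c (d ord0) (d ord_max).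
have gtM c : multilinear (gt c) by apply: bilin_multilinear.
have gtM' t' : multilinear (fun c => tlift (gt c) t').
  move=> c i k u v; rewrite -tlift_lin //.
  by apply: eq_tlift => d; rewrite /gt gM.
have L : linear (fun t => sweedler (fun c => tlift (gt c) t) x).
  move=> k u v; rewrite /sweedler -tlift_lin //.
  by apply: eq_tlift => c; rewrite linearP.
rewrite -[LHS]/(mklin L t); move: t; apply: tpow_ext => d /=.
rewrite tlift_tens; first by apply: eq_sweedler => c; rewrite tlift_tens.
move=> v i k a b; rewrite /sweedler -tlift_lin //.
by apply: eq_tlift => c; apply: gtM.
Qed.

(** The two sides are the values of one linear map, the lift of [h] to triple
   tensors, on the two sides of [comulA]. *)
Lemma sweedler2_assoc W (h : C -> C -> C -> W) x :
  (forall u, bilin (h u)) -> (forall v w, linear (fun u => h u v w)) ->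
  sweedler2 (fun u c => sweedler2 (h u) c) x
  = sweedler2 (fun c w => sweedler2 (fun u v => h u v w) c) x.
Proof.
move=> hB hL.
pose H (c : 'I_3 -> C) := h (c ord0) (c (lift ord0 ord0)) (c ord_max).
have HM : multilinear H.
  move=> v i k a b; rewrite /H /=.
  case: i => -[|[|[|//]]] Hi; rewrite /= /eq_op /=.
  - by rewrite hL.
  - by rewrite (hB _).2.
  - by rewrite (hB _).1.
have := congr1 (tlift H) (comulA x).
rewrite (tlift_map (tlift H)); last first.
  apply: (bilin_multilinear (h := fun u v : C => tcons u (comul v)));
    split=> [u|v].
    by apply: comp_lin; apply: linear_of.
  exact: tcons_lin.
rewrite (tlift_map (tlift H)); last first.
  apply: (bilin_multilinear (h := fun v u : C => trcons u (comul v)));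
    split=> [u|v].
    exact: trcons_lin.
  by apply: (comp_lin (f := trcons v)); apply: linear_of.
have hM1 u : multilinear (fun c : 'I_2 -> C => h u (c ord0) (c ord_max)).
  exact: bilin_multilinear.
have hM2 w : multilinear (fun c : 'I_2 -> C => h (c ord0) (c ord_max) w).
  by apply: (bilin_multilinear (h := fun u v => h u v w)); split=> [u|v //];
    apply: (hB u).2.
move=> E; rewrite /sweedler2.
transitivity (tlift (fun c => tlift H (tcons (c ord0) (comul (c ord_max)))) (comul x)).
  apply: eq_tlift => c; move: (comul (c ord_max)) => t.
  have L : linear (fun t => tlift H (tcons (c ord0) t)).
    by apply: comp_lin; apply: linear_of.
  rewrite -[RHS]/(mklin L t); move: t; apply: tpow_ext => v /=.
  rewrite tcons_tens !tlift_tens // /H ins_id ins_lift.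
  congr (h _ _ _); rewrite -[in LHS](ins_lift ord0 (c ord0) v).
  by congr (ins _ _ _ _); apply: val_inj.
rewrite E; apply: eq_tlift => c; move: (comul (c ord0)) => t.
have L : linear (fun t => tlift H (trcons (c ord_max) t)).
  by apply: comp_lin; apply: linear_of.
rewrite -[LHS]/(mklin L t); move: t; apply: tpow_ext => v /=.
rewrite trcons_tens !tlift_tens // /H ins_id.
by congr (h _ _ _); rewrite -[in RHS](ins_lift ord_max (c ord_max) v);
  congr (ins _ _ _ _); apply: val_inj.
Qed.

End Sweedler.

(** * Splitting and permuting the components of a Sweedler sum *)

Lemma ins_lift_perm n T (p q : 'I_n.+1) (s : 'S_n) (c : T) (v : 'I_n -> T) :
  (fun j => ins q c v (lift_perm p q s j)) = ins p c (fun j => v (s j)).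
Proof.
apply/funext => j; case: (unliftP p j) => [k|] ->.
  by rewrite lift_perm_lift !ins_lift.
by rewrite lift_perm_id !ins_id.
Qed.

Lemma bilin_ins_upd (R : comNzRingType) (V W : lmodType R) n
    (h : ('I_n.+1 -> V) -> W) (p : 'I_n.+1) i (c : 'I_n -> V) :
  multilinear h -> bilin (fun u v => h (ins p u (upd c i v))).
Proof.
move=> hM; split=> [u|v]; last exact: (multilinear_ins_lin p (upd c i v) hM).
exact: multilinear_lin c i (multilinear_ins p u hM).
Qed.

Section Double.
Variables (K : fieldType) (C : coalgType K).

(** The argument [c i] enters only through the coproduct: inside [h] the update
   overwrites it. *)
Lemma sweedler2_multilinear n (W : lmodType K) (h : ('I_n.+1 -> C) -> W) p i :
  multilinear h ->
  multilinear (fun c : 'I_n -> C => sweedler2 (fun u v => h (ins p u (upd c i v))) (c i)).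
Proof.
move=> hM; apply/multilinearP => c j k x y /=.
case: (eqVneq i j) => [->|nij].
  rewrite !upd_eq sweedler2_linear; congr (_ *: _ + _);
    by apply: eq_sweedler2 => u v; rewrite !upd_upd.
rewrite !upd_neq // /sweedler2 -tlift_lin;
  try exact: (bilin_multilinear (bilin_ins_upd p i _ hM)).
apply: eq_tlift => d; rewrite ![upd (upd c j _) _ _]updC 1?eq_sym //.
exact: (multilinear_lin _ j (multilinear_ins p (d ord0) hM)).
Qed.

(** [icomul] keeps splitting its last component. Coassociativity moves the
   first two splittings onto the first component, after the remaining sum has
   been exchanged with the coproduct of that component. *)
Lemma sweedler_double0 n (W : lmodType K) (h : ('I_n.+2 -> C) -> W) x :
  multilinear h ->
  sweedler h x =
  sweedler (fun c => sweedler2 (fun u v => h (ins ord0 u (upd c ord0 v))) (c ord0)) x.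
Proof.
move=> hM; case: n h hM => [|n] h hM.
  rewrite sweedlerS // sweedler0; last exact: sweedler2_multilinear.
  apply: eq_sweedler2 => u v; rewrite sweedler0; last exact: multilinear_ins.
  by congr (h (ins _ _ _)); apply/funext => j; rewrite [j]ord1 upd_eq.
rewrite [RHS]sweedlerS; last exact: sweedler2_multilinear.
transitivity (sweedler2 (fun y z => sweedler2 (fun u v =>
   sweedler (fun c => h (ins ord0 u (ins ord0 v c))) z) y) x); last first.
  apply: eq_sweedler2 => y z;
  rewrite -(sweedler_sweedler2 (g := fun c u v => h (ins ord0 u (ins ord0 v c)))); last 2 first.
  - by move=> u v; apply: (multilinear_ins ord0 v (multilinear_ins ord0 u hM)).
  - move=> c; have := bilin_ins_upd ord0 ord0 (ins ord0 0 c) hM.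
    by congr bilin; apply/funext => u; apply/funext => v; rewrite upd_ins.
  by apply: eq_sweedler => c; rewrite ins_id; apply: eq_sweedler2 => u v;
    rewrite upd_ins.
rewrite -sweedler2_assoc; last 2 first.
- by move=> u; apply: (sweedler_bilin (h := fun c => h (ins ord0 u c)));
  apply: multilinear_ins.
- move=> v z k a b; rewrite /sweedler -tlift_lin;
  try exact: (multilinear_ins ord0 v (multilinear_ins ord0 _ hM)).
  by apply: eq_tlift => c; apply: (multilinear_ins_lin ord0 _ hM).
rewrite sweedlerS //; apply: eq_sweedler2 => u w; rewrite sweedlerS //.
exact: multilinear_ins.
Qed.

End Double.

Section Symmetric.
Variables (K : fieldType) (C : cocomCoalgType K).

Lemma sweedler2_comm (W : lmodType K) (h : C -> C -> W) x :
  bilin h -> sweedler2 h x = sweedler2 (fun u v => h v u) x.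
Proof.
move=> hB; have hM := bilin_multilinear hB; rewrite /sweedler2 -[in LHS]comulC.
rewrite (tlift_map (tlift _)); last first.
  have := multilinear_perm (perm (@rev_ord_inj 2)) (@tens_multilinear K 2 C).
  by congr multilinear; apply/funext => v; congr tens; apply/funext => i;
    rewrite permE.
apply: eq_tlift => c; rewrite tlift_tens //.
by congr (h (c _) (c _)); apply: val_inj.
Qed.

(** Permutations fixing the first place are covered by induction on the number
   of components, and the exchange of the first two places by cocommutativity,
   once [sweedler_double0] has presented these two as the halves of one
   component. Together they generate the symmetric group. *)
Lemma sweedler_perm n (s : 'S_n.+1) (W : lmodType K) (h : ('I_n.+1 -> C) -> W) x :
  multilinear h -> sweedler (fun c => h (fun j => c (s j))) x = sweedler h x.
Proof.
elim: n s W h x => [|n IHn] s W h x hM.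
  rewrite !sweedler0 //; first by apply: multilinear_perm.
pose inv (s : 'S_n.+2) := forall (h : ('I_n.+2 -> C) -> W) x, multilinear h ->
  sweedler (fun c => h (fun j => c (s j))) x = sweedler h x.
have invM s1 s2 : inv s1 -> inv s2 -> inv (s1 * s2)%g.
  move=> i1 i2 g y gM; rewrite -[RHS]i1 // -[RHS]i2;
    last exact: multilinear_perm.
  apply: eq_sweedler => c; congr g; apply/funext => j.
  by rewrite permM.
have inv_lift (t : 'S_n.+1) : inv (lift_perm ord0 ord0 t).
  move=> g y gM; rewrite !sweedlerS //; last exact: multilinear_perm.
  apply: eq_sweedler2 => u w.
  rewrite -[RHS](IHn t _ (fun c => g (ins ord0 u c)));
    last exact: multilinear_ins.
  by apply: eq_sweedler => c; rewrite ins_lift_perm.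
have inv01 : inv (tperm ord0 (lift ord0 ord0)).
  move=> g y gM; rewrite !sweedler_double0 //; last exact: multilinear_perm.
  apply: eq_sweedler => c; rewrite sweedler2_comm; last first.
    exact: (bilin_ins_upd ord0 ord0 c (multilinear_perm _ gM)).
  apply: eq_sweedler2 => u v; congr g; apply/funext => j.
  rewrite permE /=; case: (unliftP ord0 j) => [k|] ->.
    rewrite (inj_eq lift_inj) eq_sym (negPf (neq_lift _ _)) ins_lift.
    case: (k =P ord0) => [->|/eqP nk]; first by rewrite ins_id upd_eq.
    by rewrite ins_lift !upd_neq.
  by rewrite eqxx ins_lift ins_id upd_eq.
have inv1 : inv 1%g.
  by move=> g y gM; apply: eq_sweedler => c; congr g; apply/funext => j;
    rewrite perm1.
have inv0 (i : 'I_n.+1) : inv (tperm ord0 (lift ord0 i)).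
  pose t : 'S_n.+1 := tperm ord0 i.
  have -> : tperm ord0 (lift ord0 i) =
     (tperm ord0 (lift ord0 ord0) ^ lift_perm ord0 ord0 t)%g.
    by rewrite tpermJ lift_perm_id lift_perm_lift tpermL.
  by rewrite conjgE lift_permV;
    apply: invM (inv_lift _) (invM _ _ inv01 (inv_lift _)).
have invt (i j : 'I_n.+2) : inv (tperm i j).
  case: (unliftP ord0 i) => [i'|] ->; case: (unliftP ord0 j) => [j'|] ->.
  - have -> : tperm (lift ord0 i') (lift ord0 j')
            = lift_perm ord0 ord0 (tperm i' j'); last exact: inv_lift.
    apply/permP => k; case: (unliftP ord0 k) => [k'|] ->.
      by rewrite lift_perm_lift inj_tperm //; apply: lift_inj.
    by rewrite lift_perm_id tpermD // eq_sym neq_lift.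
  - by rewrite tpermC.
  - exact: inv0.
  - by rewrite tperm1.
suff invs : inv s by apply: invs.
have [ts -> _] := prod_tpermP s.
elim: ts => [|t ts IH]; first by rewrite big_nil.
by rewrite big_cons; apply: invM.
Qed.

(** Coassociativity splits the first component; cocommutativity then allows the
   split component to be any [c i], and its second half to stand at any [p]. *)
Lemma sweedler_double n (p : 'I_n.+2) (i : 'I_n.+1) (W : lmodType K)
    (h : ('I_n.+2 -> C) -> W) x :
  multilinear h ->
  sweedler h x =
  sweedler (fun c => sweedler2 (fun u v => h (ins p v (upd c i u))) (c i)) x.
Proof.
move=> hM; pose t : 'S_n.+1 := tperm ord0 i.
pose s := (lift_perm p ord0 t)%g.
rewrite -(sweedler_perm s) // sweedler_double0; last exact: multilinear_perm.
rewrite -(sweedler_perm t);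
  last exact: (sweedler2_multilinear ord0 ord0 (multilinear_perm s hM)).
apply: eq_sweedler => c; rewrite sweedler2_comm; last first.
  exact: (bilin_ins_upd ord0 ord0 _ (multilinear_perm s hM)).
rewrite tpermL; apply: eq_sweedler2 => u v; congr h; rewrite ins_lift_perm.
congr ins; rewrite upd_perm tpermV tpermL; congr upd.
by apply/funext => j; rewrite tpermK.
Qed.

End Symmetric.

(** * Faces of the Hochschild complex and the action on homology *)

Section Faces.
Variables (K : fieldType) (A : comAlgType K).

(** Every Hochschild face is a contraction: of two neighbouring places for the
   inner faces, of the last place into the first for the cyclic one. *)
Definition contract n (p : 'I_n.+1) (i : 'I_n) (a : 'I_n.+1 -> A) : 'I_n -> A :=
  upd (fun j => a (lift p j)) i (a (lift p i) * a p).

Lemma mul_linl (b : A) : linear (fun a => a * b).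
Proof. by move=> k x y; rewrite mulrDl scalerAl. Qed.

Lemma mul_linr (b : A) : linear (fun a => b * a).
Proof. by move=> k x y; rewrite mulrDr scalerAr. Qed.

Lemma multilinear_contract n p i (W : lmodType K) (h : ('I_n -> A) -> W) :
  multilinear h -> multilinear (fun a => h (contract p i a)).
Proof.
move=> hM; apply/multilinearP => a l; case: (unliftP p l) => [m|] ->;
  last first.
  have E x : contract p i (upd a p x) = upd (fun j => a (lift p j)) i (a (lift p i) * x).
    rewrite /contract upd_eq upd_neq ?(eq_sym _ p) ?neq_lift //; congr upd.
    by apply/funext => j; rewrite upd_neq // eq_sym neq_lift.
  by move=> k x y /=; rewrite !E mul_linr (multilinear_lin _ _ hM).
have E x : (fun j => upd a (lift p m) x (lift p j)) = upd (fun j => a (lift p j)) m x.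
  by apply/funext => j; rewrite /upd (inj_eq lift_inj).
case: (eqVneq m i) => [->|nmi] k x y /=.
  have E' z : contract p i (upd a (lift p i) z) = upd (fun j => a (lift p j)) i (z * a p).
    rewrite /contract upd_eq (upd_neq _ _ (neq_lift _ _)).
    by apply/funext => j; rewrite /upd; case: eqP => // nji;
      rewrite (inj_eq lift_inj); case: eqP.
  by rewrite !E' mul_linl (multilinear_lin _ _ hM).
have E' z : contract p i (upd a (lift p m) z) = upd (contract p i a) m z.
  rewrite /contract (upd_neq _ _ (neq_lift _ _)) E.
  by rewrite upd_neq ?(inj_eq lift_inj) 1?eq_sym // updC.
by rewrite !E' (multilinear_lin _ _ hM).
Qed.

Lemma hfaceE n (a : 'I_n.+2 -> A) (i : 'I_n.+1) :
  hface a i = contract (lift ord0 i) i a.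
Proof.
apply/funext => j; rewrite /hface /contract /upd.
have lj : (j < i)%N -> widen_ord (leqnSn n.+1) j = lift (lift ord0 i) j.
  move=> ji; apply: val_inj; rewrite /= /bump leqNgt.
  by rewrite ltnS (ltnW ji).
have ii : widen_ord (leqnSn n.+1) i = lift (lift ord0 i) i.
  by apply: val_inj; rewrite /= /bump leqNgt ltnS leqnn.
case: (ltngtP j i) => [ji|ij|/val_inj->].
- by rewrite lj // -val_eqE /= ltn_eqF.
- rewrite -val_eqE /= gtn_eqF //; congr a; apply: val_inj.
  by rewrite /= /bump ij.
- by rewrite eqxx ii.
Qed.

Lemma hface_lastE n (a : 'I_n.+2 -> A) :
  hface_last a = contract ord_max ord0 a.
Proof.
apply/funext => j; rewrite /hface_last /contract /upd.
case: eqP => _; last by congr a; apply: val_inj;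
  rewrite /= /bump leqNgt ltn_ord.
by rewrite mulrC; congr (a _ * _); apply: val_inj.
Qed.

Lemma hoch_b_tens n (a : 'I_n.+2 -> A) :
  hoch_b A n (tens a) = \sum_(i < n.+1) (-1) ^+ i *: tens (contract (lift ord0 i) i a)
                      + (-1) ^+ n.+1 *: tens (contract ord_max ord0 a).
Proof.
rewrite /hoch_b tlift_tens ?hface_lastE.
  by under eq_bigr do rewrite hfaceE.
apply: multilinear_add.
  apply: multilinear_sum => i; apply: multilinear_scale.
  have := multilinear_contract (lift ord0 i) i (@tens_multilinear K n.+1 A).
  by congr multilinear; apply/funext => v; rewrite hfaceE.
apply: multilinear_scale;
  have := multilinear_contract ord_max ord0 (@tens_multilinear K n.+1 A).
by congr multilinear; apply/funext => v; rewrite hface_lastE.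
Qed.

Lemma cycle_val_lin n : linear (fun z : hoch_cycle A n => kermod_val z).
Proof. exact: (linearP val). Qed.

Lemma HH_of_cycle n (z : hoch_cycle A n) : HH_of (kermod_val z) = HH_class z.
Proof. by rewrite /HH_of valKd. Qed.

Lemma cycle_d n (z : hoch_cycle A n) : hoch_d A n (kermod_val z) = 0.
Proof. by case: z => c /= /eqP. Qed.

Lemma HH_of_cycleP n (c : hoch A n) (Hc : hoch_d A n c = 0) :
  exists2 z : hoch_cycle A n, kermod_val z = c & HH_of c = HH_class z.
Proof.
have Hc' : c \in ker_pred (hoch_d A n) by apply/eqP.
by exists (Kermod Hc') => //; rewrite -HH_of_cycle.
Qed.

Lemma HH_surj n (q : HH A n) : exists z : hoch_cycle A n, q = HH_class z.
Proof.
by exists (generic_quotient.repr q); rewrite /HH_class quotmod_reprK.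
Qed.

(** [HH_of] is additive only between cycles, since it sends every other chain
   to zero. *)
Lemma HH_of_lin n k (c d : hoch A n) :
  hoch_d A n c = 0 -> hoch_d A n d = 0 ->
  HH_of (k *: c + d) = k *: HH_of c + HH_of d.
Proof.
move=> /HH_of_cycleP[z <- ->] /HH_of_cycleP[w <- ->].
rewrite -[RHS](linearP (quotmod_pi _)) -[RHS]HH_of_cycle.
by congr HH_of; rewrite cycle_val_lin.
Qed.

Lemma HH_ofD n (c d : hoch A n) :
  hoch_d A n c = 0 -> hoch_d A n d = 0 -> HH_of (c + d) = HH_of c + HH_of d.
Proof. by move=> c0 d0; have := HH_of_lin 1 c0 d0; rewrite !scale1r. Qed.

Lemma HH_of0 n : HH_of (0 : hoch A n) = 0.
Proof.
have := HH_of_lin (-1) (linear0 (hoch_d A n)) (linear0 (hoch_d A n)).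
by rewrite scaler0 addr0 scaleN1r addNr.
Qed.

Lemma HH_ofN n (c : hoch A n) : hoch_d A n c = 0 -> HH_of (- c) = - HH_of c.
Proof.
move=> c0; have := HH_of_lin (-1) c0 (linear0 (hoch_d A n)).
by rewrite HH_of0 !addr0 !scaleN1r.
Qed.

Lemma HH_of_boundary n (c : hoch A n.+1) : hoch_d A n (hoch_b A n c) = 0 ->
  HH_of (hoch_b A n c) = 0.
Proof.
move=> /HH_of_cycleP[z Ez ->]; rewrite -[0](linear0 (quotmod_pi _)).
by apply/quotmod_piP; rewrite subr0; apply: span_gen; exists c.
Qed.

Lemma HH_of_homologous n (b : hoch A n.+1) (c d : hoch A n) :
  hoch_d A n c = 0 -> hoch_d A n d = 0 -> hoch_b A n b = c - d ->
  HH_of c = HH_of d.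
Proof.
move=> c0 d0 E; have b0 : hoch_d A n (hoch_b A n b) = 0.
  by rewrite E linearB /= c0 d0 subrr.
by rewrite -(subrK d c) -E HH_ofD // HH_of_boundary // add0r.
Qed.

End Faces.

Lemma HH_lift (K : fieldType) (A : comAlgType K) n (W : lmodType K)
    (f : hoch_cycle A n -> W) :
  linear f -> (forall z c, hoch_b A n c = kermod_val z -> f z = 0) ->
  forall z, induced (@HH_class K A n) f (HH_class z) = f z.
Proof.
move=> fL f0; apply: inducedE.
by apply: (quotmod_lift (f := mklin fL)) => z [c /f0].
Qed.

Section ChainMap.
Variables (K : fieldType) (C : cocomCoalgType K) (A A' : comAlgType K).
Variables (Phi : measuring C A A').

Definition meas_args n (a : 'I_n -> A) (c : 'I_n -> C) : 'I_n -> A' :=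
  fun i => Phi (c i) (a i).

Lemma multilinear_meas_args n (a : 'I_n -> A) (W : lmodType K) (h : ('I_n -> A') -> W) :
  multilinear h -> multilinear (fun c => h (meas_args a c)).
Proof.
by apply: (multilinear_arg (f := fun i c => Phi c (a i))) => i;
  apply: meas_linear.
Qed.

Lemma multilinear_meas_argsl n (c : 'I_n -> C) (W : lmodType K) (h : ('I_n -> A') -> W) :
  multilinear h -> multilinear (fun a => h (meas_args a c)).
Proof.
by apply: (multilinear_arg (f := fun i => Phi (c i))) => i; apply: linear_of.
Qed.

Lemma multilinear_sweedler_meas n x (W : lmodType K) (h : ('I_n.+1 -> A') -> W) :
  multilinear h -> multilinear (fun a => sweedler (fun c => h (meas_args a c)) x).
Proof.
move=> hM a i k y z; rewrite /sweedler -tlift_lin;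
  try exact: multilinear_meas_args.
by apply: eq_tlift => c; apply: (multilinear_meas_argsl c hM).
Qed.

Lemma hoch_meas_tens n x (a : 'I_n.+1 -> A) :
  hoch_meas Phi x n (tens a) = sweedler (fun c => tens (meas_args a c)) x.
Proof.
by rewrite /hoch_meas tlift_tens //; apply: multilinear_sweedler_meas;
  apply: tens_multilinear.
Qed.

(** The multiplication rule of the measuring splits the component acting on the
   contracted entry; [sweedler_double] says that letting the two halves act on
   the two factors is the same as using one more component from the start. *)
Lemma meas_contract n (p : 'I_n.+2) (i : 'I_n.+1) (a : 'I_n.+2 -> A)
    (W : lmodType K) (h : ('I_n.+1 -> A') -> W) x :
  multilinear h ->
  sweedler (fun c => h (meas_args (contract p i a) c)) x
  = sweedler (fun c => h (contract p i (meas_args a c))) x.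
Proof.
move=> hM; rewrite [RHS](sweedler_double p i); last first.
  by apply: (multilinear_meas_args a (multilinear_contract p i hM)).
apply: eq_sweedler => c.
pose w := fun j => Phi (c j) (a (lift p j)).
have E : meas_args (contract p i a) c
    = upd w i (sweedler2 (fun u v => Phi u (a (lift p i)) * Phi v (a p)) (c i)).
  rewrite /sweedler2 -measM; apply/funext => j.
  by rewrite /meas_args /contract /upd; case: eqP => [->|].
rewrite E (sweedler2_map (f := fun y => h (upd w i y))); last 2 first.
- exact: multilinear_lin.
- split=> [u|v].
    apply: (comp_lin (f := fun b => _ * b)); first exact: mul_linr.
    exact: meas_linear.
  apply: (comp_lin (f := fun b => b * _)); first exact: mul_linl.
  exact: meas_linear.
apply: eq_sweedler2 => u v; congr h;
  rewrite /contract /meas_args ins_id ins_lift upd_eq.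
apply/funext => j; rewrite /upd; case: eqP => // nji; rewrite ins_lift.
by case: eqP.
Qed.

(** Each face commutes with the measuring separately, because it is a
   contraction. For the cyclic face this rests on cocommutativity. *)
Lemma hoch_meas_b n x (t : hoch A n.+1) :
  hoch_b A' n (hoch_meas Phi x n.+1 t) = hoch_meas Phi x n (hoch_b A n t).
Proof.
have L1 : linear (fun t => hoch_b A' n (hoch_meas Phi x n.+1 t)).
  by apply: comp_lin; apply: linear_of.
have L2 : linear (fun t => hoch_meas Phi x n (hoch_b A n t)).
  by apply: comp_lin; apply: linear_of.
apply: (tpow_ext (f := mklin L1) (g := mklin L2)) => a /=.
rewrite hoch_meas_tens hoch_b_tens.
rewrite (sweedler_map (f := hoch_b A' n)); last 2 first.
- exact: linear_of.
- by apply: multilinear_meas_args; apply: tens_multilinear.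
under eq_sweedler do rewrite hoch_b_tens.
rewrite linearD linearZ linear_sum /=.
under [in RHS]eq_bigr do rewrite linearZ /= hoch_meas_tens
  (meas_contract _ _ _ _ (@tens_multilinear K n.+1 A')).
rewrite hoch_meas_tens (meas_contract _ _ _ _ (@tens_multilinear K n.+1 A')).
pose T p i c := tens (contract p i (meas_args a c)) : tpow n.+1 A'.
have TM p i : multilinear (T p i).
  exact: (multilinear_meas_args a (multilinear_contract p i (@tens_multilinear K n.+1 A'))).
rewrite (sweedlerD (h := fun c => \sum_(i < n.+1) (-1) ^+ i *: T _ i c)
  (h' := fun c => _ *: T _ _ c)); last 2 first.
- by apply: multilinear_sum => i; apply: multilinear_scale.
- by apply: multilinear_scale.
rewrite sweedlerZ // (sweedler_sum _ (h := fun (i : 'I_n.+1) c => (-1) ^+ i *: T _ i c)).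
  by congr (_ + _); apply: eq_bigr => i _; rewrite sweedlerZ.
by move=> i; apply: multilinear_scale.
Qed.

Lemma hoch_meas_cycle n x (z : hoch_cycle A n) :
  hoch_d A' n (hoch_meas Phi x n (kermod_val z)) = 0.
Proof.
case: n z => [//|n] z /=.
by have := cycle_d z; rewrite /= hoch_meas_b => ->; rewrite linear0.
Qed.

Lemma HH_measE n x (z : hoch_cycle A n) :
  HH_meas Phi x n (HH_class z) = HH_of (hoch_meas Phi x n (kermod_val z)).
Proof.
apply: HH_lift => [k u v|{}z c Ec].
  by rewrite linearP -HH_of_lin // hoch_meas_cycle.
rewrite -Ec -hoch_meas_b HH_of_boundary // hoch_meas_b Ec.
exact: hoch_meas_cycle.
Qed.

End ChainMap.

(** * Antisymmetrized chains and their boundaries *)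

Lemma eqN0 (K : fieldType) (V : lmodType K) (v : V) :
  [pchar K] =i pred0 -> v = - v -> v = 0.
Proof.
move=> charK0 vN; apply/eqP.
have : (2%:R : K) *: v == 0 by rewrite scaler_nat mulr2n {2}vN subrr.
by rewrite scaler_eq0 ((pcharf0P _).1 charK0).
Qed.

Lemma lift_lift0 n (p : 'I_n.+1) (j : 'I_n) :
  lift (lift ord0 p) (lift ord0 j) = lift ord0 (lift p j).
Proof. by apply: val_inj; rewrite /= /bump !add1n ltnS addnS. Qed.

Lemma lift_lift00 n (p : 'I_n.+1) : lift (lift ord0 p) ord0 = ord0.
Proof. exact: val_inj. Qed.

Lemma sum_lift_perm n (V : nmodType) (p : 'I_n.+1) (F : 'S_n.+1 -> V) :
  \sum_s F s = \sum_l \sum_(t : 'S_n) F (lift_perm p l t).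
Proof.
rewrite pair_bigA /=;
  apply: (reindex (fun lt : 'I_n.+1 * 'S_n => lift_perm p lt.1 lt.2)).
apply: onW_bij; apply: inj_card_bij;
  last by rewrite card_prod card_ord !card_Sn factS.
move=> [l t] [l' t'] /= E.
have El : l = l' by rewrite -(lift_perm_id p l t) E lift_perm_id.
suff Et : t = t' by rewrite El Et.
apply/permP => j; apply: (@lift_inj _ l).
by rewrite -(lift_perm_lift p) E El lift_perm_lift.
Qed.

Lemma sign_lift_perm (R : pzRingType) n (p l : 'I_n.+1) (t : 'S_n) :
  (-1) ^+ lift_perm p l t = (-1) ^+ p * ((-1) ^+ l * (-1) ^+ t) :> R.
Proof. by rewrite odd_lift_perm 2!signr_addb -mulrA !signr_odd. Qed.

Section Antisymmetrization.
Variables (K : fieldType) (A : comAlgType K).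
Implicit Types (x y z : A).

Definition chain n x (u : 'I_n -> A) : hoch A n := tens (ins ord0 x u).

Lemma contract_ins0 n x (p : 'I_n.+1) (u : 'I_n.+1 -> A) :
  contract (lift ord0 p) ord0 (ins ord0 x u)
  = ins ord0 (x * u p) (fun j => u (lift p j)).
Proof.
apply/funext => j; case: (unliftP ord0 j) => [i|] ->.
  by rewrite /contract upd_neq ?ins_lift ?lift_lift0 ?ins_lift // eq_sym neq_lift.
by rewrite /contract upd_eq lift_lift00 !ins_id ins_lift.
Qed.

Lemma contract_insS n x (p : 'I_n.+1) (k : 'I_n) (u : 'I_n.+1 -> A) :
  contract (lift ord0 p) (lift ord0 k) (ins ord0 x u)
  = ins ord0 x (contract p k u).
Proof.
apply/funext => j; rewrite /contract /upd; case: (unliftP ord0 j) => [i|] ->.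
  by rewrite (inj_eq lift_inj) !lift_lift0 !ins_lift.
by rewrite (negPf (neq_lift _ _)) lift_lift00 !ins_id.
Qed.

Lemma hoch_b_chain n x (u : 'I_n.+1 -> A) :
  hoch_b A n (chain x u) =
    chain (x * u ord0) (fun j => u (lift ord0 j))
    + \sum_(k < n) (-1) ^+ k.+1 *: chain x (contract (lift ord0 k) k u)
    + (-1) ^+ n.+1 *: chain (x * u ord_max) (fun j => u (lift ord_max j)).
Proof.
rewrite hoch_b_tens big_ord_recl expr0 scale1r contract_ins0.
have -> : ord_max = lift ord0 ord_max :> 'I_n.+2 by apply: val_inj.
rewrite contract_ins0; congr (_ + _ + _).
by apply: eq_bigr => k _; rewrite contract_insS.
Qed.

Definition alt n x (w : 'I_n -> A) : hoch A n :=
  \sum_(s : 'S_n) (-1) ^+ s *: chain x (fun j => w (s j)).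

Lemma antisymE n (a : 'I_n.+1 -> A) :
  antisym a = alt (a ord0) (fun j => a (lift ord0 j)).
Proof.
rewrite /antisym (reindex_inj invg_inj); apply: eq_bigr => s _.
rewrite odd_permV; congr (_ *: tens _); apply/funext => j.
by rewrite /act_args invgK /ins.
Qed.

Lemma alt_perm n x (w : 'I_n -> A) (r : 'S_n) :
  alt x (fun j => w (r j)) = (-1) ^+ r *: alt x w.
Proof.
rewrite /alt [in RHS](reindex_inj (mulIg r)) scaler_sumr.
apply: eq_bigr => s _;
  rewrite scalerA odd_permM signr_addb mulrC -mulrA -expr2 sqrr_sign mulr1.
by congr (_ *: chain _ _); apply/funext => j; rewrite permM.
Qed.

(** The involution which composes [s] with the exchange of the places [k] and
   [k+1] changes the signature of [s], but not the contraction, as [A] is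
   commutative. So the sum is its own opposite. *)
Lemma contract_pairing n x (k : 'I_n) (w : 'I_n.+1 -> A) (f : 'S_n.+1 -> K) :
  [pchar K] =i pred0 ->
  (forall s, f (tperm (lift (lift ord0 k) k) (lift ord0 k) * s)%g = f s) ->
  \sum_s (f s * (-1) ^+ s) *: chain x (contract (lift ord0 k) k (fun j => w (s j))) = 0.
Proof.
move=> charK0 ft; apply: eqN0 => //; set t := tperm _ _ in ft.
rewrite {1}(reindex_inj (mulgI t)) -sumrN; apply: eq_bigr => s _.
have nk : lift (lift ord0 k) k != lift ord0 k by rewrite eq_sym neq_lift.
rewrite ft odd_mul_tperm nk /= signrN mulrN scaleNr; congr (- (_ *: chain _ _)).
apply/funext => j; rewrite /contract /upd !permM tpermL tpermR mulrC.
case: eqP => // nj; rewrite tpermD //; last by rewrite neq_lift.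
by rewrite (inj_eq lift_inj); apply/eqP => /esym.
Qed.

(** The first and the last face both multiply a letter [l] into [x] and leave
   an arrangement [t] of the other letters. The two permutations giving the
   same [l] and [t] differ by a cyclic shift, of signature [(-1) ^ n]; with the
   sign [(-1) ^ (n + 1)] of the last face, the two weights get subtracted. *)
Lemma outer_faces n x (w : 'I_n.+1 -> A) (f : 'S_n.+1 -> K) :
  \sum_s (f s * (-1) ^+ s) *: chain (x * w (s ord0)) (fun j => w (s (lift ord0 j)))
  + (-1) ^+ n.+1 *:
    \sum_s (f s * (-1) ^+ s) *:
       chain (x * w (s ord_max)) (fun j => w (s (lift ord_max j)))
  = \sum_(l < n.+1) (-1) ^+ l *: \sum_(t : 'S_n)
      ((f (lift_perm ord0 l t) - f (lift_perm ord_max l t)) * (-1) ^+ t) *: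
        chain (x * w l) (fun j => w (lift l (t j))).
Proof.
rewrite (sum_lift_perm ord0) (sum_lift_perm ord_max) scaler_sumr -big_split.
apply: eq_bigr => l _; rewrite !scaler_sumr -big_split;
  apply: eq_bigr => t _ /=.
have E p : (fun j => w (lift_perm p l t (lift p j))) = (fun j => w (lift l (t j))).
  by apply/funext => j; rewrite lift_perm_lift.
rewrite !E !lift_perm_id !scalerA -scalerDl !sign_lift_perm; congr (_ *: _).
rewrite expr0 mul1r exprS; have := sqrr_sign K n; move: ((-1) ^+ n) => e.
rewrite expr2 mulrBl mulrBr => ee; congr (_ + _).
  by rewrite mulrCA.
by rewrite mulN1r mulNr; congr (- _);
  rewrite mulrCA (mulrA e e) ee mul1r mulrCA.
Qed.

Lemma hoch_b_weighted n x (w : 'I_n.+1 -> A) (f : 'S_n.+1 -> K) :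
  hoch_b A n (\sum_s (f s * (-1) ^+ s) *: chain x (fun j => w (s j))) =
  \sum_(l < n.+1) (-1) ^+ l *: \sum_(t : 'S_n)
      ((f (lift_perm ord0 l t) - f (lift_perm ord_max l t)) * (-1) ^+ t) *:
        chain (x * w l) (fun j => w (lift l (t j)))
  + \sum_(k < n) (-1) ^+ k.+1 *: \sum_s (f s * (-1) ^+ s) *:
      chain x (contract (lift ord0 k) k (fun j => w (s j))).
Proof.
rewrite -outer_faces linear_sum /=.
under eq_bigr do rewrite linearZ /= hoch_b_chain !scalerDr scaler_sumr.
rewrite !big_split /= -!addrA; congr (_ + _); rewrite addrC; congr (_ + _).
  by rewrite scaler_sumr; apply: eq_bigr => s _; rewrite !scalerA mulrC.
rewrite exchange_big; apply: eq_bigr => k _ /=; rewrite scaler_sumr.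
by apply: eq_bigr => s _; rewrite !scalerA mulrC.
Qed.

(** For the constant weight both the inner and the outer faces cancel. *)
Lemma alt_cycle n x (w : 'I_n -> A) : [pchar K] =i pred0 ->
  hoch_d A n (alt x w) = 0.
Proof.
move=> charK0; case: n w => [//|n] w.
have -> : alt x w = \sum_(s : 'S_n.+1) (1 * (-1) ^+ s) *: chain x (fun j => w (s j)).
  by apply: eq_bigr => s _; rewrite mul1r.
rewrite /= hoch_b_weighted big1 ?add0r => [|l _].
  rewrite big1 // => k _;
    rewrite (contract_pairing _ _ (f := fun=> 1)) ?scaler0 //.
by rewrite big1 ?scaler0 // => t _; rewrite subrr mul0r scale0r.
Qed.

(** If [P] comes before [Q], exchanging two neighbouring places keeps this
   order unless [P] and [Q] are these two places. This makes the weight used in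
   [alt_leibniz] eligible for [contract_pairing]. *)
Lemma tperm_before n (k : 'I_n) (P Q : 'I_n.+1) :
  let k0 := lift (lift ord0 k) k in let k1 := lift ord0 k in
  let ok (P Q : 'I_n.+1) := (P < Q)%N && ~~ ((P == k0) && (Q == k1)) in
  P != Q -> ok (tperm k0 k1 P) (tperm k0 k1 Q) = ok P Q.
Proof.
move=> k0 k1 ok nPQ; rewrite /ok.
have v0 : (k0 = k :> nat)%N by rewrite /= /bump ltnn.
have v1 : (k1 = k.+1 :> nat)%N by [].
clear ok; clearbody k0 k1.
have T (S : 'I_n.+1) : tperm k0 k1 S =
    (if S == k :> nat then k.+1 else if S == k.+1 :> nat then k : nat else S) :> nat.
  case: tpermP => [->|->|/eqP + /eqP]; rewrite ?v0 ?v1 ?eqxx //.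
    by rewrite eqn_leq ltnn.
  by rewrite -!val_eqE /= v0 v1 => /negPf -> /negPf ->.
move: nPQ; rewrite -!val_eqE /= !T v0 v1.
by do ?[case: ifP => ?]; lia.
Qed.

(** Consider the word with letters [y], [z] and the entries of [a] other than
   the one at [q0], and take the signed sum of its arrangements in which [y]
   comes before [z]. In the boundary, the inner faces cancel in pairs except
   where [y] stands immediately before [z], which produces [y * z]. The outer
   faces cancel except when the letter multiplied into [x] is [y], which may be
   first but not last, or [z], which may be last but not first. *)
Lemma alt_leibniz n x y z (q0 : 'I_n) (a : 'I_n -> A) :
  [pchar K] =i pred0 ->
  exists c, hoch_b A n c = alt (x * y) (upd a q0 z) + alt (x * z) (upd a q0 y)
                           - alt x (upd a q0 (y * z)).
Proof.
case: n q0 a => [[[] //]|n] q0 a.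
move=> charK0; pose w := ins ord0 y (upd a q0 z); pose q := lift ord0 q0.
pose before (s : 'S_n.+2) := (s^-1%g ord0 < s^-1%g q)%N.
pose f (s : 'S_n.+2) : K := (before s)%:R.
exists (\sum_s (f s * (-1) ^+ s) *: chain x (fun j => w (s j))).
rewrite hoch_b_weighted; congr (_ + _).
  have q0l : q != ord0 by rewrite eq_sym neq_lift.
  (* Only the letters [y], numbered [0], and [z], numbered [q], survive. *)
  rewrite (bigD1 ord0) // (bigD1 q) //= [X in _ + (_ + X)]big1 ?addr0;
    last first.
    move=> l /andP[nl0 nlq]; rewrite big1 ?scaler0 // => t _.
    suff -> : f (lift_perm ord0 l t) = f (lift_perm ord_max l t).
      by rewrite subrr mul0r scale0r.
    rewrite /f /before !lift_permV.
    have [i0 E0] : exists i, ord0 = lift l i.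
      by case: (unlift_some nl0) => i ->; exists i.
    have [i1 E1] : exists i, q = lift l i.
      by case: (unlift_some nlq) => i ->; exists i.
    by rewrite E0 E1 !lift_perm_lift /= /bump; congr (_%:R); lia.
  congr (_ + _).
    rewrite expr0 scale1r /alt; apply: eq_bigr => t _.
    rewrite /f /before !lift_permV !lift_perm_id !lift_perm_lift.
    rewrite (_ : (ord0 < _)%N = true) // (_ : (ord_max < _)%N = false);
      last first.
      by apply/negbTE; rewrite -leqNgt -ltnS ltn_ord.
    rewrite subr0 mul1r /w ins_id; congr (_ *: chain _ _); apply/funext => j.
    by rewrite ins_lift.
  (* Without [z], the word starts with [y]; [r] brings [y] back to [q0]. *)
  pose r : 'S_n.+1 := lift_perm ord0 q0 1.
  transitivity ((-1) ^+ q0 *: alt (x * z) (fun j => upd a q0 y (r j)));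
    last first.
    rewrite alt_perm sign_lift_perm expr0 odd_perm1 mul1r mulr1 scalerA.
    by rewrite -expr2 sqrr_sign scale1r.
  rewrite /alt !scaler_sumr; apply: eq_bigr => t _.
  have E0 : ord0 = lift q ord0 by apply: val_inj.
  rewrite /f /before !lift_permV !lift_perm_id ltn0 [X in lift_perm _ ord_max _ X]E0.
  rewrite lift_perm_lift lift_max ltn_ord sub0r !scalerA.
  rewrite -[1 *- true]/(- 1 : K) exprS mulN1r mulN1r mulrNN /w ins_lift upd_eq.
  congr (_ *: chain _ _).
  apply/funext => j; case: (unliftP ord0 (t j)) => [i|] ->.
    rewrite lift_lift0 ins_lift lift_perm_lift perm1 !upd_neq // eq_sym neq_lift //.
  by rewrite -E0 ins_id lift_perm_id upd_eq.
pose k0 (k : 'I_n.+1) : 'I_n.+2 := lift (lift ord0 k) k.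
pose here (k : 'I_n.+1) (s : 'S_n.+2) := (s^-1%g ord0 == k0 k) && (s^-1%g q == lift ord0 k).
have here_before k s : here k s -> before s.
  by case/andP=> /eqP e0 /eqP e1; rewrite /before e0 e1 /= /bump ltnn.
(* Removing the arrangements in [here k] leaves a sum to which the pairing
   applies; those in [here k] are the words with [y * z] at place [k]. *)
have inner (k : 'I_n.+1) : \sum_s (f s * (-1) ^+ s) *:
      chain x (contract (lift ord0 k) k (fun j => w (s j)))
    = (-1) ^+ k *: \sum_(t : 'S_n.+1 | t^-1%g q0 == k) (-1) ^+ t *:
        chain x (fun j => upd a q0 (y * z) (t j)).
  transitivity (\sum_s ((here k s)%:R * (-1) ^+ s) *:
      chain x (contract (lift ord0 k) k (fun j => w (s j)))).
    apply/eqP; rewrite -subr_eq0 -sumrB; apply/eqP.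
    under eq_bigr do rewrite -scalerBl -mulrBl.
    apply: (contract_pairing x w (f := fun s => f s - (here k s)%:R)) => // s.
    have E s' : f s' - (here k s')%:R = (before s' && ~~ here k s')%:R.
      rewrite /f; move: (here_before k s').
      by case: (before s') (here k s') => [] [] //= e;
        rewrite ?subrr ?subr0 //; have := e isT.
    rewrite !E; congr ((nat_of_bool _)%:R);
      rewrite /before /here !invMg tpermV !permM.
    have nPQ : s^-1%g ord0 != s^-1%g q by rewrite (inj_eq perm_inj) neq_lift.
    exact: (tperm_before k nPQ).
  rewrite (sum_lift_perm (k0 k)) (bigD1 ord0) //= [X in _ + X]big1 ?addr0.
    rewrite scaler_sumr [in RHS]big_mkcond; apply: eq_bigr => t _.
    have E0 : lift ord0 k = lift (k0 k) k.
      by apply: val_inj; rewrite /k0 /= /bump ltnn add0n leqnn.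
    rewrite /here lift_permV lift_perm_id eqxx lift_perm_lift E0 (inj_eq lift_inj) /=.
    case: eqP => [Ek|_]; last by rewrite mul0r scale0r.
    rewrite mul1r scalerA sign_lift_perm expr0 mul1r;
      congr (_ * _ *: chain _ _).
      by rewrite /= /bump ltnn.
    apply/funext => j; rewrite /contract -E0 /upd.
    rewrite -/(k0 k) lift_perm_id E0 lift_perm_lift /w ins_id ins_lift /upd.
    have Etk : t k = q0 by rewrite -Ek permKV.
    rewrite -Etk (inj_eq perm_inj) eqxx [j == k]eq_sym mulrC.
    case: eqP => [<-|njk]; first by rewrite eqxx.
    have -> : lift (lift (k0 k) k) j = lift (k0 k) j.
      have v0 : k0 k = k :> nat by rewrite /k0 /= /bump ltnn.
      have jk : nat_of_ord j != k by apply/eqP => /val_inj /esym.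
      apply: val_inj; rewrite -E0 [RHS]/(bump (k0 k) j) v0 /=.
      rewrite /bump leq0n add1n ltn_neqAle eq_sym jk.
      by [].
    by rewrite lift_perm_lift ins_lift /upd (inj_eq perm_inj) eq_sym; case: eqP.
  move=> l nl; rewrite big1 // => t _.
  have [i0 E0] : exists i, ord0 = lift l i.
    by case: (unlift_some nl) => i ->; exists i.
  rewrite /here lift_permV [X in lift_perm _ _ _ X]E0 lift_perm_lift.
  by rewrite eq_sym (negPf (neq_lift _ _)) mul0r scale0r.
under eq_bigr do rewrite inner scalerA exprS mulN1r mulNr -expr2 sqrr_sign scaleN1r.
rewrite sumrN; congr (- _); rewrite /alt.
under eq_bigr do rewrite big_mkcond.
rewrite exchange_big; apply: eq_bigr => t _ /=.
by rewrite -big_mkcond (big_pred1 (t^-1%g q0)) // => k; rewrite eq_sym.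
Qed.

End Antisymmetrization.

(** * Differential forms and the projection from chains *)

Section KaehlerD.
Variables (K : fieldType) (A : comAlgType K).
Implicit Types (a b x y z : A).
Local Notation d := (@kaehler_d K A).

Lemma kaehler_dlin (k : K) a b : d (k *: a + b) = k%:A *: d a + d b.
Proof.
rewrite -[RHS]linearP; apply/quotmod_piP.
exact/span_gen/KaehlerLinear.
Qed.

Lemma kaehler_dM a b : d (a * b) = a *: d b + b *: d a.
Proof.
rewrite -[b *: d a]linearZ -[RHS]linearP; apply/quotmod_piP.
exact/span_gen/KaehlerLeibniz.
Qed.

Lemma span_Omega1 (m : Omega1 A) : span (fun m => exists a, m = d a) m.
Proof.
apply: (span_sub _ (span_quot m (@span_freeg A A))) => _ [_ [a ->] ->].
by exists a.
Qed.

Lemma kaehler_lift (N : lmodType A) (f : A -> N) :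
  (forall (k : K) a b, f (k *: a + b) = k%:A *: f a + f b) ->
  (forall a b, f (a * b) = a *: f b + b *: f a) ->
  forall a, induced d f (d a) = f a.
Proof.
move=> fL fM; apply: inducedE.
have [g gE] := freeg_lift f.
have [|h hE] := @quotmod_lift _ _ (@kaehler_rel K A) N g.
  move=> _ [k a b|a b]; rewrite linearB linearD ![g (_ *: _)]linearZ /= !gE.
    by rewrite fL subrr.
  by rewrite fM subrr.
by exists h => a; rewrite hE gE.
Qed.

End KaehlerD.

Section Wedge.
Variables (R : comNzRingType) (p : nat) (M : lmodType R).

Lemma wedge_multilinear : multilinear (@wedge R p M).
Proof.
by apply: multilinear_comp; [apply: linear_of|apply: tens_multilinear].
Qed.

Lemma wedge_alt (v : 'I_p -> M) i j : i != j -> v i = v j -> wedge v = 0.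
Proof.
move=> nij vij; rewrite -[0](linear0 (quotmod_pi _)); apply/quotmod_piP.
by rewrite subr0; apply: span_gen; exists i j.
Qed.

End Wedge.

Section Forms.
Variables (K : fieldType) (A : comAlgType K).
Implicit Types (x y z : A).
Local Notation d := (@kaehler_d K A).

Definition kform p x (u : 'I_p -> A) : Omega A p := dform (ins ord0 x u).

Lemma kformE p x (u : 'I_p -> A) :
  kform x u = to_restr (x *: wedge (fun i => d (u i))).
Proof.
rewrite /kform /dform ins_id; congr (to_restr (_ *: wedge _)).
by apply/funext => i; rewrite ins_lift.
Qed.

Lemma dformE p (a : 'I_p.+1 -> A) :
  dform a = kform (a ord0) (fun j => a (lift ord0 j)).
Proof. by rewrite kformE. Qed.

Lemma kform_lin p (u : 'I_p -> A) : linear (fun x => kform x u).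
Proof.
move=> k x y; rewrite !kformE -to_restrZ -to_restrD; congr to_restr.
by rewrite scalerDl scalerA -scalerAl mul1r.
Qed.

Lemma kform_multilinear p x : multilinear (fun u : 'I_p -> A => kform x u).
Proof.
apply/multilinearP => u i k y z; rewrite !kformE -to_restrZ -to_restrD.
congr to_restr; rewrite !(upd_comp (fun _ => d)) kaehler_dlin.
by rewrite (multilinear_lin _ _ (@wedge_multilinear A p (Omega1 A))) scalerDr !scalerA mulrC.
Qed.

Lemma kform_leibniz p x y z (u : 'I_p -> A) i :
  kform x (upd u i (y * z)) = kform (x * y) (upd u i z) + kform (x * z) (upd u i y).
Proof.
rewrite !kformE -to_restrD; congr to_restr; rewrite !(upd_comp (fun _ => d)).
rewrite kaehler_dM (multilinear_lin _ _ (@wedge_multilinear A p (Omega1 A))) scalerDr scalerA.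
congr (_ + _); rewrite -scalerA; congr (_ *: _).
exact: (multilinearZ _ i z (d y) (@wedge_multilinear A p (Omega1 A))).
Qed.

(** Polarization: [F y z] vanishes for [y = z], hence at [u i + u j]. *)
Lemma kform_tperm p x (u : 'I_p -> A) i j : i != j ->
  kform x (fun k => u (tperm i j k)) = - kform x u.
Proof.
move=> nij; pose F y z := kform x (upd (upd u i y) j z).
have FD z : {morph F ^~ z : y y' / y + y'}.
  move=> y y'; rewrite /F ![upd (upd u i _) _ _]updC //.
  by have := multilinear_lin (upd u j z) i (@kform_multilinear p x) 1 y y';
    rewrite !scale1r.
have FDr y : {morph F y : z z' / z + z'}.
  move=> z z'.
  by have := multilinear_lin (upd u i y) j (@kform_multilinear p x) 1 z z'; rewrite !scale1r.
have F0 y : F y y = 0.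
  rewrite /F kformE (@wedge_alt _ _ _ _ i j) ?scaler0 //.
  by rewrite upd_neq // !upd_eq.
have -> : kform x u = F (u i) (u j) by rewrite /F !upd_id.
have -> : kform x (fun k => u (tperm i j k)) = F (u j) (u i).
  rewrite /F; congr kform; apply/funext => k; rewrite /upd.
  by case: tpermP => [->|->|/eqP/negPf -> /eqP/negPf ->];
    rewrite ?eqxx ?(negPf nij).
apply/eqP; rewrite -addr_eq0; have /eqP := F0 (u i + u j).
by rewrite FD !FDr !F0 add0r addr0 addrC.
Qed.

Lemma kform_perm p x (u : 'I_p -> A) (s : 'S_p) :
  kform x (fun k => u (s k)) = (-1) ^+ s *: kform x u.
Proof.
have [ts -> ds] := prod_tpermP s.
elim: ts ds u => [|t ts IH] /= ds u.
  by rewrite big_nil odd_perm1 scale1r; congr kform; apply/funext => k;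
    rewrite perm1.
case/andP: ds => dt dts;
  rewrite big_cons odd_mul_tperm dt signrN scaleNr -IH //.
rewrite -(kform_tperm _ _ dt); congr kform; apply/funext => k.
by rewrite permM.
Qed.

End Forms.

Section Forms.
Variables (K : fieldType) (A : comAlgType K).
Implicit Types (x y z : A).
Local Notation d := (@kaehler_d K A).

Lemma dform_multilinear p : multilinear (@dform K A p).
Proof.
apply/multilinearP => a l; case: (unliftP ord0 l) => [m|] -> k y z /=.
  have E t : (fun j => upd a (lift ord0 m) t (lift ord0 j))
      = upd (fun j => a (lift ord0 j)) m t.
    by apply/funext => j; rewrite /upd (inj_eq lift_inj).
  have E0 t : upd a (lift ord0 m) t ord0 = a ord0 by rewrite upd_neq ?neq_lift.
  have E' t : dform (upd a (lift ord0 m) t)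
      = kform (a ord0) (upd (fun j => a (lift ord0 j)) m t).
    by rewrite dformE E E0.
  rewrite -!/(upd a _ _) !E'.
  exact: (multilinear_lin (fun j => a (lift ord0 j)) m (@kform_multilinear K A p (a ord0)) k y z).
have E t : dform (upd a ord0 t) = kform t (fun j => a (lift ord0 j)).
  by rewrite dformE upd_eq.
by rewrite !E kform_lin.
Qed.

(** The maps are linear over [K] only, while forms are generated over [A].
   Hence the predicate [Q], which asks for agreement on all multiples by [A],
   and is therefore stable under the action of [A]. *)
Lemma Omega_ext p (W : lmodType K) (f g : {linear Omega A p -> W}) :
  (forall a, f (dform a) = g (dform a)) -> f =1 g.
Proof.
move=> fg.
pose Q (m : extpow p (Omega1 A)) := forall b : A, f (to_restr (b *: m)) = g (to_restr (b *: m)).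
have Q0 : Q 0 by move=> b;
  rewrite scaler0 -[to_restr 0]/(0 : Omega A p) !linear0.
have QD m n : Q m -> Q n -> Q (m + n).
  by move=> Qm Qn b; rewrite scalerDr to_restrD !linearD Qm Qn.
have QZ c m : Q m -> Q (c *: m) by move=> Qm b; rewrite scalerA Qm.
have Qw v : Q (wedge v).
  apply: (multilinear_gen (G := fun m => exists a, m = d a) (Q := Q)) v => //.
  - exact: wedge_multilinear.
  - exact: span_Omega1.
  - move=> v /choice [a va] b; have := fg (ins ord0 b a);
    rewrite -/(kform b a) kformE.
    by have -> : v = (fun i => d (a i)) by apply/funext.
suff QT m : Q m by move=> m; have := QT m 1; rewrite scale1r.
elim: (span_extpow m) => {m} [_ [v ->]||m n _ Qm _ Qn|c m _ Qm] //.
- exact: QD.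
- exact: QZ.
Qed.

Lemma pi_chain_chain p x (u : 'I_p -> A) : pi_chain A p (chain x u) = kform x u.
Proof. by rewrite /pi_chain tlift_tens //; apply: dform_multilinear. Qed.

Lemma pi_chain_alt p x (u : 'I_p -> A) :
  pi_chain A p (alt x u) = (p`!)%:R *: kform x u.
Proof.
rewrite /alt linear_sum /=.
under eq_bigr do rewrite linearZ /= pi_chain_chain kform_perm scalerA -expr2 sqrr_sign scale1r.
by rewrite sumr_const card_Sn scaler_nat.
Qed.

(** Each product [d(u_k u_(k+1))] splits by the Leibniz rule into the two forms
   [x u_l . d(u without u_l)] for [l = k] and [l = k+1]; the sum telescopes. *)
Lemma pi_chain_b p (t : hoch A p.+1) : pi_chain A p (hoch_b A p t) = 0.
Proof.
have L : linear (fun t => pi_chain A p (hoch_b A p t)).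
  by apply: comp_lin; apply: linear_of.
rewrite -[LHS]/(mklin L t) -[RHS]/((\0 : {linear hoch A p.+1 -> Omega A p}) t).
move: t; apply: tpow_ext => a /=; rewrite -(insK ord0 a).
set x := a ord0; set u := a \o lift ord0.
rewrite -/(chain x u) hoch_b_chain.
pose E l := kform (x * u l) (fun j => u (lift l j)).
rewrite !linearD linear_sum /= linearZ /= !pi_chain_chain -/(E ord0) -/(E ord_max).
have merge (k : 'I_p) : kform x (contract (lift ord0 k) k u)
    = E (lift (lift ord0 k) k) + E (lift ord0 k).
  rewrite /contract kform_leibniz /E; congr (kform _ _ + kform _ _).
    apply/funext => j; rewrite /upd; case: eqP => [->|njk].
      by congr u; apply: val_inj; rewrite /= /bump ltnn add0n leqnn.
    have jk : nat_of_ord j != k by apply/eqP => /val_inj.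
    congr u; apply: val_inj; rewrite /= /bump ltnn leq0n add0n add1n.
    by rewrite ltn_neqAle eq_sym jk.
  apply/funext => j; rewrite /upd; case: eqP => [->|//].
  by congr u; apply: val_inj; rewrite /= /bump ltnn.
under eq_bigr do rewrite linearZ /= pi_chain_chain merge.
pose e i := (-1) ^+ i *: E (inord i).
have e0 : E ord0 = e 0%N.
  by rewrite /e expr0 scale1r; congr E; apply: val_inj; rewrite /= inordK.
have eS (k : 'I_p) : (-1) ^+ k.+1 *: (E (lift (lift ord0 k) k) + E (lift ord0 k))
    = e k.+1 - e k.
  rewrite /e scalerDr addrC; congr (_ *: E _ + _).
    by apply: val_inj; rewrite /= inordK // ltnS.
  rewrite exprS mulN1r scaleNr; congr (- (_ *: E _)).
  by apply: val_inj; rewrite /= /bump ltnn inordK // ltnS ltnW.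
have en : (-1) ^+ p.+1 *: E ord_max = - e p.
  rewrite exprS mulN1r scaleNr; congr (- (_ *: E _)).
  by apply: val_inj; rewrite /= inordK.
under eq_bigr do rewrite eS.
rewrite -(big_mkord xpredT (fun k => e k.+1 - e k)) telescope_sumr // e0 en.
by rewrite addrCA subrr addr0 subrr.
Qed.

Lemma hpiE p (z : hoch_cycle A p) : hpi A p (HH_class z) = pi_chain A p (kermod_val z).
Proof.
apply: HH_lift => [|{}z c <-]; last exact: pi_chain_b.
by apply: comp_lin; [apply: linear_of|apply: cycle_val_lin].
Qed.

End Forms.

(** * The universal property of differential forms *)

Section ExtendDerivations.
Variables (K : fieldType) (A : comAlgType K) (N : lmodType A).
Local Notation d := (@kaehler_d K A).

Definition derivation (f : A -> N) :=
  (forall (k : K) a b, f (k *: a + b) = k%:A *: f a + f b) /\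
  (forall a b, f (a * b) = a *: f b + b *: f a).

(** Differentials generate the module, so a relation between derivations passes
   to the linear maps they induce. *)
Lemma induced_comb (a1 a2 : A) (f f1 f2 : A -> N) (m : Omega1 A) :
  derivation f -> derivation f1 -> derivation f2 ->
  (forall y, f y = a1 *: f1 y + a2 *: f2 y) ->
  induced d f m = a1 *: induced d f1 m + a2 *: induced d f2 m.
Proof.
move=> [fL fM] [f1L f1M] [f2L f2M] E.
have L : linear (fun m => a1 *: induced d f1 m + a2 *: induced d f2 m).
  move=> c x y; rewrite (linearP (induced d f1)) (linearP (induced d f2)).
  by rewrite !scalerDr !scalerA ![c * _]mulrC addrACA.
apply: (span_eq (g := mklin L) (span_Omega1 m)) => _ [y ->] /=.
by rewrite !kaehler_lift // E.
Qed.

Variables (p : nat) (D : ('I_p -> A) -> N).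
Hypothesis DD : forall u i, derivation (fun y => D (upd u i y)).

(** [H v u] reads its first [k] arguments in [v], as differentials, and the
   others in [u], as elements of [A]. The first clause expresses both this and
   the agreement with [D]. *)
Lemma extend_derivations_upto k : exists H : ('I_p -> Omega1 A) -> ('I_p -> A) -> N,
  [/\ forall v u u', (forall i : 'I_p, (i < k)%N -> v i = d (u' i)) ->
        (forall i : 'I_p, (k <= i)%N -> u i = u' i) -> H v u = D u',
      forall v u (i : 'I_p), (i < k)%N -> linear (fun m => H (upd v i m) u)
    & forall v u (i : 'I_p), (k <= i)%N -> derivation (fun y => H v (upd u i y))].
Proof.
elim: k => [|k [H [Ha Hb Hc]]].
  exists (fun=> D); split=> // v u u' _ E; congr D; apply/funext => i.
  exact: E.
case: (ltnP k p) => [lt_kp|le_pk]; last first.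
  have kF (i : 'I_p) : (k <= i)%N = false.
    by apply/negbTE; rewrite -ltnNge (leq_trans (ltn_ord i)).
  exists H; split=> [v u u' E _|v u i _|v u i /ltnW]; last by rewrite kF.
    by apply: Ha => i; rewrite ?kF // => ik; apply: E; apply: ltnW.
  by apply: Hb; rewrite ltnNge kF.
pose o := Ordinal lt_kp.
(* Place [o] of [v] is erased, so that [v o] occurs only as the argument of the
   induced map and linearity in it is immediate. *)
pose F v u y := H (upd v o 0) (upd u o y).
have FD v u : derivation (F v u) by apply: Hc.
have no (i : 'I_p) : (i < k)%N -> i != o by move=> ik;
  rewrite -val_eqE /= ltn_eqF.
have no' (i : 'I_p) : (k < i)%N -> i != o by move=> ik;
  rewrite -val_eqE /= gtn_eqF.
exists (fun v u => induced d (F v u) (v o)); split.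
- move=> v u u' Ev Eu; rewrite Ev //=; case: (FD v u) => FL FM.
  rewrite kaehler_lift //; apply: Ha => i ik.
    by rewrite upd_neq ?no // Ev // ltnW.
  rewrite /upd; case: eqP => [->//|/eqP ni]; apply: Eu.
  by rewrite ltn_neqAle ik andbT eq_sym.
- move=> v u i; rewrite ltnS leq_eqVlt => /predU1P[Ei|ik].
    have -> : i = o by [apply: val_inj]; move=> c m m'.
    have EF x : F (upd v o x) u = F v u by rewrite /F upd_upd.
    by rewrite !EF !upd_eq linearP.
  move=> c m m'; rewrite -[X in _ = _ + X]scale1r.
  have E x : upd v i x o = v o by rewrite upd_neq // eq_sym no.
  rewrite !E; apply: induced_comb => // y; rewrite /F scale1r.
  by rewrite !(updC _ _ _ (no _ ik)) Hb.
- move=> v u i ki; have nio := no' _ ki.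
  have E y y' : F v (upd u i y) y' = H (upd v o 0) (upd (upd u o y') i y).
    by rewrite /F updC.
  split=> [c y z|y z].
    rewrite -[X in _ = _ + X]scale1r; apply: induced_comb => // y'.
    by rewrite scale1r !E (Hc _ _ _ (ltnW ki)).1.
  apply: induced_comb => // y'.
  by rewrite !E (Hc _ _ _ (ltnW ki)).2.
Qed.

(** For [k = p] no argument is read in [A] any more. *)
Lemma extend_derivations : exists H : ('I_p -> Omega1 A) -> N,
  multilinear H /\ forall u, H (fun i => d (u i)) = D u.
Proof.
have [H [Ha Hb _]] := extend_derivations_upto p.
exists (fun v => H v (fun=> 0)); split=> [|u]; last first.
  by apply: Ha => // i; rewrite leqNgt ltn_ord.
by apply/multilinearP => v i; apply: Hb.
Qed.

End ExtendDerivations.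

Section Coinduced.
Variables (K : fieldType) (A : comAlgType K) (W : lmodType K).

(** The linear maps from [A] to [W], on which [A] acts through the argument.
   Evaluation at [1] turns an [A]-linear map into this module into a [K]-linear
   map to [W]. *)
Record coind := Coind { coind_fun :> A -> W; coind_lin : linear coind_fun }.

Lemma coind_ext (f g : coind) : f =1 g -> f = g.
Proof.
case: f g => [f fL] [g gL] /= /funext E; case: _ / E gL => gL.
by congr Coind; apply: Prop_irrelevance.
Qed.

HB.instance Definition _ := gen_eqMixin coind.
HB.instance Definition _ := gen_choiceMixin coind.

Fact coind0_lin : linear (fun _ : A => 0 : W).
Proof. by move=> k x y; rewrite scaler0 addr0. Qed.
Fact coindN_lin (f : coind) : linear (fun a => - f a).
Proof. by move=> k x y; rewrite (coind_lin f) opprD scalerN. Qed.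
Fact coindD_lin (f g : coind) : linear (fun a => f a + g a).
Proof.
by move=> k x y; rewrite (coind_lin f) (coind_lin g) scalerDr addrACA.
Qed.
Fact coindZ_lin b (f : coind) : linear (fun a => f (b * a)).
Proof. by move=> k x y; rewrite mul_linr (coind_lin f). Qed.

Definition coindD f g := Coind (coindD_lin f g).
Definition coindZ b f := Coind (coindZ_lin b f).

Fact coindDA : associative coindD.
Proof. by move=> f g h; apply: coind_ext => a /=; rewrite addrA. Qed.
Fact coindDC : commutative coindD.
Proof. by move=> f g; apply: coind_ext => a /=; rewrite addrC. Qed.
Fact coind0D : left_id (Coind coind0_lin) coindD.
Proof. by move=> f; apply: coind_ext => a /=; rewrite add0r. Qed.
Fact coindND : left_inverse (Coind coind0_lin) (fun f => Coind (coindN_lin f)) coindD.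
Proof. by move=> f; apply: coind_ext => a /=; rewrite addNr. Qed.

HB.instance Definition _ :=
  GRing.isZmodule.Build coind coindDA coindDC coind0D coindND.

Fact coindZA a b f : coindZ a (coindZ b f) = coindZ (a * b) f.
Proof. by apply: coind_ext => c /=; rewrite mulrA (mulrC b). Qed.
Fact coind1Z : left_id 1 coindZ.
Proof. by move=> f; apply: coind_ext => a /=; rewrite mul1r. Qed.
Fact coindZDr : right_distributive coindZ +%R.
Proof. by move=> a f g; apply: coind_ext. Qed.
Fact coindZDl f : {morph coindZ^~ f : a b / a + b}.
Proof.
move=> a b; apply: coind_ext => c /=; rewrite mulrDl.
by have := coind_lin f 1 (a * c) (b * c); rewrite !scale1r.
Qed.

HB.instance Definition _ := GRing.Zmodule_isLmodule.Build A coind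
  coindZA coind1Z coindZDr coindZDl.

Lemma coindDE (f g : coind) a : (f + g) a = f a + g a.
Proof. by []. Qed.

Lemma coindZE b (f : coind) a : (b *: f) a = f (b * a).
Proof. by []. Qed.

End Coinduced.

(** Forms are built from quotients and tensor powers over [A], but the map
   wanted is only [K]-linear. Reading [h x u] as a function of [x] gives a
   family in the coinduced [A]-module, whose extension to differentials is
   [A]-multilinear. It is antisymmetric because [h] is, so in characteristic
   [0] it is alternating and descends to the exterior power. *)
Lemma Omega_lift (K : fieldType) (A : comAlgType K) p (W : lmodType K)
    (h : A -> ('I_p -> A) -> W) :
  [pchar K] =i pred0 ->
  (forall u, linear (fun x => h x u)) -> (forall x, multilinear (h x)) ->
  (forall x u i y z, h x (upd u i (y * z))
     = h (x * y) (upd u i z) + h (x * z) (upd u i y)) ->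
  (forall x u i j, i != j -> h x (fun k => u (tperm i j k)) = - h x u) ->
  exists g : {linear Omega A p -> W}, forall x u, g (kform x u) = h x u.
Proof.
move=> charK0 h_lin h_ml h_leib h_anti.
pose D (u : 'I_p -> A) : coind A W := Coind (h_lin u).
have DD u i : derivation (fun y => D (upd u i y)).
  split=> [k y z|y z]; apply: coind_ext => a; rewrite coindDE !coindZE /=.
    by rewrite (multilinear_lin u i (h_ml a)) -scalerAl mul1r (linZ _ _ (h_lin _)).
  by rewrite h_leib (mulrC y) (mulrC z).
have [H [HM HE]] := extend_derivations DD.
have H_anti i j : i != j -> forall v, H (fun k => v (tperm i j k)) + H v = 0.
  move=> nij v.
  apply: (multilinear_gen (H := fun v => H (fun k => v (tperm i j k)) + H v)
    (G := fun m => exists a, m = kaehler_d a) (Q := fun f => f = 0)) => //.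
  - by apply: multilinear_add => //; apply: (multilinear_perm (tperm i j)).
  - exact: span_Omega1.
  - by move=> x y -> ->; rewrite addr0.
  - by move=> k x ->; rewrite scaler0.
  - move=> {}v /choice [u vu].
    have -> : v = (fun i => kaehler_d (u i)) by apply/funext.
    rewrite !HE; apply: coind_ext => a.
    by rewrite coindDE /= h_anti // addNr.
have H_alt t : alternating_rel t -> tlift H t = 0.
  case=> v i j nij vij; rewrite tlift_tens //; apply: coind_ext => a.
  have := H_anti i j nij v.
  have -> : (fun k => v (tperm i j k)) = v.
    by apply/funext => k; case: tpermP => [->|->|].
  move=> /(congr1 (fun f : coind A W => f a)); rewrite coindDE => /eqP.
  by rewrite addr_eq0 => /eqP /(eqN0 charK0).
have [G GE] := quotmod_lift H_alt.
have gL : linear (fun m : Omega A p => (G m : coind A W) 1).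
  move=> k m n; rewrite -[k *: m]/((k%:A : A) *: (m : extpow p (Omega1 A))).
  rewrite -[_ + n]/((_ : extpow p (Omega1 A)) + n).
  rewrite (linearP G) coindDE coindZE mulr1; congr (_ + _).
  exact: (linZ k 1 (coind_lin (G m))).
exists (mklin gL) => x u;
  rewrite kformE /= /to_restr (linZ _ _ (linear_of G)) coindZE.
by rewrite /wedge GE tlift_tens // HE /= mulr1.
Qed.

(** * The antisymmetrization map and the action on forms *)

Section Eps.
Variables (K : fieldType) (charK0 : [pchar K] =i pred0) (A : comAlgType K).

Lemma chain_lin p (u : 'I_p -> A) : linear (fun x => chain x u).
Proof. exact: multilinear_ins_lin ord0 u (@tens_multilinear K p.+1 A). Qed.

Lemma alt_lin p (u : 'I_p -> A) : linear (fun x => alt x u).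
Proof.
move=> k x y; rewrite scaler_sumr -big_split; apply: eq_bigr => s _.
by rewrite chain_lin scalerDr !scalerA mulrC.
Qed.

Lemma alt_multilinear p x : multilinear (fun u : 'I_p -> A => alt x u).
Proof.
apply: multilinear_sum => s; apply: multilinear_scale.
exact: (multilinear_perm s (multilinear_ins ord0 x (@tens_multilinear K p.+1 A))).
Qed.

Lemma antisym_cycle p (a : 'I_p.+1 -> A) : hoch_d A p (antisym a) = 0.
Proof. by rewrite antisymE alt_cycle. Qed.

(** Well-definedness of the antisymmetrization map: the Leibniz rule holds
   because its defect is the boundary found in [alt_leibniz]. *)
Lemma epsE p (a : 'I_p.+1 -> A) : eps A p (dform a) = HH_of (antisym a).
Proof.
move: a; apply: inducedE.
have [g gE] : exists g : {linear Omega A p -> HH A p},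
    forall x u, g (kform x u) = HH_of (alt x u).
  apply: Omega_lift => //.
  - by move=> u k x y; rewrite alt_lin HH_of_lin // alt_cycle.
  - by move=> x u i k y z; rewrite alt_multilinear HH_of_lin // alt_cycle.
  - move=> x u i y z; have [c Ec] := alt_leibniz x y z i u charK0.
    transitivity (HH_of (alt (x * y) (upd u i z) + alt (x * z) (upd u i y))).
      apply/esym/(HH_of_homologous _ _ Ec); last exact: alt_cycle.
      by rewrite linearD /= !alt_cycle // addr0.
    by apply: HH_ofD; apply: alt_cycle.
  - move=> x u i j nij; rewrite alt_perm odd_tperm nij expr1 scaleN1r.
    by rewrite HH_ofN // alt_cycle.
by exists g => a; rewrite dformE gE antisymE.
Qed.

End Eps.

Section Measurings.
Variables (K : fieldType) (charK0 : [pchar K] =i pred0).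
Variables (A A' : comAlgType K) (C : cocomCoalgType K) (Phi : measuring C A A').

(** As [HH_of] is not linear on all chains, the sum is first formed in the
   module of cycles. *)
Lemma HH_of_sweedler n (g : ('I_n.+1 -> C) -> hoch A' n) x :
  multilinear g -> (forall c, hoch_d A' n (g c) = 0) ->
  HH_of (sweedler g x) = sweedler (fun c => HH_of (g c)) x.
Proof.
move=> gM g0.
have gker c : g c \in ker_pred (hoch_d A' n) by apply/eqP.
pose Z c : hoch_cycle A' n := Kermod (gker c).
have ZM : multilinear Z.
  by move=> v i k y z; apply: val_inj; rewrite /= gM.
have -> : sweedler g x = kermod_val (sweedler Z x).
  by rewrite (sweedler_map x (@cycle_val_lin K A' n) ZM).
rewrite HH_of_cycle (sweedler_map (f := @HH_class K A' n)) //.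
  by apply: eq_sweedler => c; rewrite -HH_of_cycle.
exact: (linear_of (quotmod_pi _)).
Qed.

Lemma dform_meas_multilinear p (a : 'I_p.+1 -> A) :
  multilinear (fun c => dform (meas_args Phi a c)).
Proof. exact: multilinear_meas_args (@dform_multilinear K A' p). Qed.

Lemma act_argsE (B : comAlgType K) p (s : 'S_p) (a : 'I_p.+1 -> B) :
  act_args s a = (fun i => a (lift_perm ord0 ord0 s^-1%g i)).
Proof.
apply/funext => i; rewrite /act_args; case: unliftP => [j|] ->.
  by rewrite lift_perm_lift.
by rewrite lift_perm_id.
Qed.

Lemma tens_act_args_multilinear (B : comAlgType K) p (s : 'S_p) :
  multilinear (fun a => tens (act_args s a) : hoch B p).
Proof.
have := multilinear_perm (lift_perm ord0 ord0 s^-1%g) (@tens_multilinear K p.+1 B).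
by congr multilinear; apply/funext => a; rewrite act_argsE.
Qed.

Lemma antisym_multilinear (B : comAlgType K) p : multilinear (@antisym K B p).
Proof.
by apply: multilinear_sum => s; apply: multilinear_scale;
  apply: tens_act_args_multilinear.
Qed.

(** Permuting the entries of [a] amounts to permuting the components of [x]
   that act on them, up to a permutation of the result. *)
Lemma hoch_meas_antisym p x (a : 'I_p.+1 -> A) :
  hoch_meas Phi x p (antisym a) = sweedler (fun c => antisym (meas_args Phi a c)) x.
Proof.
pose T (s : 'S_p) c := tens (act_args s (meas_args Phi a c)) : hoch A' p.
have TM s : multilinear (T s).
  exact: (multilinear_meas_args Phi a (@tens_act_args_multilinear A' p s)).
rewrite (sweedler_sum _ (h := fun s c => (-1) ^+ (s : 'S_p) *: T s c)) => [|s].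
  rewrite linear_sum; apply: eq_bigr => s _ /=.
  rewrite sweedlerZ // linearZ /= hoch_meas_tens; congr (_ *: _).
  pose r := lift_perm ord0 ord0 s^-1%g.
  rewrite -[RHS](sweedler_perm r^-1%g) //; apply: eq_sweedler => c.
  rewrite /T !act_argsE; congr tens; apply/funext => i.
  by rewrite /meas_args permK.
exact: multilinear_scale.
Qed.

Lemma HH_meas_antisym p x (a : 'I_p.+1 -> A) :
  HH_meas Phi x p (HH_of (antisym a))
  = HH_of (sweedler (fun c => antisym (meas_args Phi a c)) x).
Proof.
have [z Ez ->] := HH_of_cycleP (antisym_cycle charK0 a).
by rewrite HH_measE Ez hoch_meas_antisym.
Qed.

Lemma pi_chain_antisym (B : comAlgType K) p (b : 'I_p.+1 -> B) :
  pi_chain B p (antisym b) = (p`!)%:R *: dform b.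
Proof. by rewrite antisymE pi_chain_alt dformE. Qed.

Lemma hpi_HH_of (B : comAlgType K) p (c : hoch B p) :
  hoch_d B p c = 0 -> hpi B p (HH_of c) = pi_chain B p c.
Proof. by move=> /HH_of_cycleP[z <- ->]; rewrite hpiE. Qed.

Lemma sweedler_antisym_cycle p x (a : 'I_p.+1 -> A) :
  hoch_d A' p (sweedler (fun c => antisym (meas_args Phi a c)) x) = 0.
Proof.
have [z Ez _] := HH_of_cycleP (antisym_cycle charK0 a).
by rewrite -hoch_meas_antisym -Ez hoch_meas_cycle.
Qed.

(** The antisymmetrization followed by the projection to forms is
   multiplication by the factorial of [p]. So transporting forms to homology,
   acting there, and coming back with the inverse factorial is a linear map
   with the required values; so the prescription on forms is consistent. *)
Lemma Omega_measE p x (a : 'I_p.+1 -> A) :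
  Omega_meas Phi x p (dform a) = sweedler (fun c => dform (meas_args Phi a c)) x.
Proof.
move: a; apply: inducedE.
have L : linear (fun m => (p`!%:R)^-1 *: hpi A' p (HH_meas Phi x p (eps A p m))).
  move=> k m n; rewrite (linearP (eps A p)) (linearP (HH_meas Phi x p)) (linearP (hpi A' p)).
  by rewrite scalerDr !scalerA mulrC.
exists (mklin L) => a /=; rewrite epsE // HH_meas_antisym.
rewrite hpi_HH_of ?sweedler_antisym_cycle //.
rewrite (sweedler_map (f := pi_chain A' p)); last 2 first.
- exact: linear_of.
- exact: (multilinear_meas_args Phi a (@antisym_multilinear A' p)).
under eq_sweedler do rewrite pi_chain_antisym.
rewrite sweedlerZ; last exact: dform_meas_multilinear.
rewrite scalerA mulVf ?scale1r //.
by rewrite ((pcharf0P _).1 charK0) -lt0n fact_gt0.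
Qed.

Lemma Omega_meas_pi_chain p x (t : hoch A p) :
  Omega_meas Phi x p (pi_chain A p t) = pi_chain A' p (hoch_meas Phi x p t).
Proof.
have L1 : linear (fun t => Omega_meas Phi x p (pi_chain A p t)).
  by apply: comp_lin; apply: linear_of.
have L2 : linear (fun t => pi_chain A' p (hoch_meas Phi x p t)).
  by apply: comp_lin; apply: linear_of.
apply: (tpow_ext (f := mklin L1) (g := mklin L2)) => a /=.
rewrite hoch_meas_tens (sweedler_map (f := pi_chain A' p)); last 2 first.
- exact: linear_of.
- exact: (multilinear_meas_args Phi a (@tens_multilinear K p.+1 A')).
rewrite /pi_chain tlift_tens ?Omega_measE //; last exact: dform_multilinear.
by apply: eq_sweedler => c; rewrite tlift_tens //; apply: dform_multilinear.
Qed.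

End Measurings.

Theorem proposition2p5 (K : fieldType) (charK0 : [pchar K] =i pred0)
    (A A' : comAlgType K) (C : cocomCoalgType K) (Phi : measuring C A A')
    (x : C) :
  (forall p : nat,
     HH_meas Phi x p \o eps A p =1 eps A' p \o Omega_meas Phi x p) /\
  (forall p : nat,
     Omega_meas Phi x p \o hpi A p =1 hpi A' p \o HH_meas Phi x p).
Proof.
split=> p.
  have L1 : linear (HH_meas Phi x p \o eps A p).
    by apply: comp_lin; apply: linear_of.
  have L2 : linear (eps A' p \o Omega_meas Phi x p).
    by apply: comp_lin; apply: linear_of.
  apply: (Omega_ext (f := mklin L1) (g := mklin L2)) => a /=.
  rewrite epsE // HH_meas_antisym // Omega_measE //.
  rewrite (sweedler_map (f := eps A' p)); last 2 first.
  - exact: linear_of.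
  - exact: dform_meas_multilinear.
  rewrite HH_of_sweedler; last 2 first.
  - exact: (multilinear_meas_args Phi a (@antisym_multilinear K A' p)).
  - by move=> c; apply: antisym_cycle.
  by apply: eq_sweedler => c; rewrite epsE.
move=> q /=; have [z ->] := HH_surj q.
rewrite hpiE HH_measE Omega_meas_pi_chain // hpi_HH_of //.
exact: hoch_meas_cycle.
Qed.
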